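(* Let $\overleftarrow\sigma=(\sigma_n:\mathcal A_{n+1}^*\to\mathcal A_n^* )_{n\ge0}$ be an everywhere growing, totally recognizable directive sequence generating the subshift $X\subseteq\mathcal A_0^{\mathbb Z}$. Then the linear map $\mathfrak m_{\overleftarrow\sigma}:\mathcal V(\overleftarrow\sigma)\to\mathcal M(X)$ is a bijection. In particular, for every $n\ge0$ the measure transfer map $\sigma_{[0,n)}^{\mathcal M}:\mathcal M(X_n)\to\mathcal M(X)$ is a linear bijection of cones, and likewise the composition $\mathfrak m_{\overleftarrow\sigma}\circ\overleftarrow\zeta:\mathcal M(\overleftarrow\sigma)\to\mathcal M(X)$ is a bijection.
   Context: Directive sequence: non-erasing monoid morphisms $\sigma_n:\mathcal A_{n+1}^*\to\mathcal A_n^*$ over finite alphabets; $\sigma_{[n,m)}=\sigma_n\circ\cdots\circ\sigma_{m-1}$; everywhere growing: $\min_{a\in\mathcal A_n}|\sigma_{[0,n)}(a)|\to\infty$. $X_k\subseteq\mathcal A_k^{\mathbb Z}$ is the subshift generated by $(\sigma_n)_{n\ge k}$: all $\mathbf x$ whose finite factors occur in some $\sigma_{[k,n)}(a)$, $a\in\mathcal A_n$; $X=X_0$. Totally recognizable: each $\sigma_n$ is recognizable in $X_{n+1}$, where $\sigma:\mathcal A^*\to\mathcal B^*$ is recognizable in $Y$ if whenever $\mathbf x,\mathbf x'\in Y$ and $T^k(\sigma^{\mathbb Z}(\mathbf x))=T^\ell(\sigma^{\mathbb Z}(\mathbf x'))$ with $0\le k<|\sigma(x_1)|$, $0\le\ell<|\sigma(x'_1)|$,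 then $\mathbf x=\mathbf x'$, $k=\ell$ ($T$ the shift, $\sigma^{\mathbb Z}(\mathbf x)$ has positive half $\sigma(x_1)\sigma(x_2)\cdots$ and negative part $\cdots\sigma(x_{-1})\sigma(x_0)$). $M(\sigma)=(|\sigma(a)|_b)_{b,a}$. $\mathcal V(\overleftarrow\sigma)$: vector towers $(\vec v_n)$, $\vec v_n\in\mathbb R_{\ge0}^{\mathcal A_n}$, $\vec v_n=M(\sigma_n)\vec v_{n+1}$. $\mathfrak m_{\overleftarrow\sigma}(\overleftarrow v)$ is the invariant measure $\mu$ on $X$ with $\mu([w])=\lim_n\sum_{a\in\mathcal A_n}\vec v_n(a)|\sigma_{[0,n)}(a)|_w$ ($[w]$ the cylinder of $w$ at positions $1..|w|$, $|u|_w$ overlapping occurrences). $\mathcal M(Y)$: finite shift-invariant Borel measures supported in $Y$. Measure transfer for non-erasing $\sigma$: $\sigma^{\mathcal M}(\mu)([w'])=\sum_{\alpha_\sigma(w)=w'}\mu([\widehat w])$ where $\mathcal A_\sigma=\{a(k):1\le k\le|\sigma(a)|\}$, $\pi_\sigma(a)=a(1)\cdots a(|\sigma(a)|)$, $\alpha_\sigma(a(k))$ the $k$-th letter of $\sigma(a)$, $\widehat w$ the shortest word whose $\pi_\sigma$-image contains $w$ (with value $0$ if none). $\mathcal M(\overleftarrow\sigma)$: measure towers $(\mu_n)$, $\mu_n$ invariant on $\mathcal A_n^{\mathbb Z}$, $\mu_n=\sigma_n^{\mathcal M}(\mu_{n+1})$; $\overleftarrow\zeta((\mu_n))=((\mu_n([a]))_{a\in\mathcal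 A_n})_n$. *)

(* Defs.v *)
From HB Require Import structures.
From mathcomp Require Import all_boot all_order all_algebra.
From mathcomp Require Import all_classical all_reals all_analysis.
Set Implicit Arguments. Unset Strict Implicit. Unset Printing Implicit Defensive.
Import Order.TTheory GRing.Theory Num.Theory.
Local Open Scope classical_set_scope.
Local Open Scope ring_scope.

Definition subst {A B : Type} (f : A -> seq B) (w : seq A) : seq B :=
  flatten (map f w).

Definition non_erasing {A B : finType} (f : A -> seq B) : Prop :=
  forall a, (0 < size (f a))%N.

Definition occ {B : eqType} (w u : seq B) : nat :=
  count (fun i => take (size w) (drop i u) == w) (iota 0%N (size u - size w)%N.+1).

Section Shift.
Variables (B : finType) (b0 : B).

Definition shsp : Type := (fun _ : B => int -> B) b0.
HB.instance Definition _ := Choice.on shsp.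
HB.instance Definition _ := isPointed.Build shsp (fun _ => b0).

Definition factor (x : int -> B) (i : int) (n : nat) : seq B :=
  [seq x (i + j%:Z)%R | j <- iota 0%N n].

Definition gcyl (i : int) (w : seq B) : set shsp :=
  [set x | factor x i (size w) = w].

Definition cylinders : set (set shsp) :=
  [set C | exists i w, C = gcyl i w].

(* B^Z with the sigma-algebra generated by cylinders (= Borel sets) *)
Definition shspace := g_sigma_algebraType cylinders.

Definition cyl (w : seq B) : set shspace := gcyl 1 w.

Definition shift (x : shsp) : shsp := fun i => x (i + 1)%R.

Definition shift_invariant (R : realType) (mu : set shspace -> \bar R) : Prop :=
  forall E : set shspace, measurable E -> mu (shift @^-1` E) = mu E.

Definition inv_fin_measure (R : realType) (mu : {measure set shspace -> \bar R})
  : Prop := (mu setT < +oo)%E /\ shift_invariant mu.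

Definition supported_in (R : realType) (Y : set (int -> B))
  (mu : {measure set shspace -> \bar R}) : Prop := mu (~` Y) = 0%E.

Definition inM (R : realType) (Y : set (int -> B))
  (mu : {measure set shspace -> \bar R}) : Prop :=
  inv_fin_measure mu /\ supported_in Y mu.

Definition meq (R : realType) (mu1 mu2 : {measure set shspace -> \bar R}) : Prop :=
  forall E : set shspace, measurable E -> mu1 E = mu2 E.

End Shift.
Arguments cyl {B} b0 w.

Section Recog.
Variables (A B : finType).

(* starting position of the block sigma(x_i) in sigma^Z(x):
   block of x_1 starts at position 1, block of x_0 ends at position 0 *)
Definition start (f : A -> seq B) (x : int -> A) (i : int) : int :=
  if (0 < i)%R then
    (1 + (\sum_(j < (absz i).-1) size (f (x (j.+1)%:Z)))%N%:Z)%R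
  else
    (1 - (\sum_(j < (absz i).+1) size (f (x (- (j%:Z))%R)))%N%:Z)%R.

(* y = sigma^Z(x) : positive half f(x_1) f(x_2) ..., negative part
   ... f(x_{-1}) f(x_0) *)
Definition sigmaZ (f : A -> seq B) (x : int -> A) (y : int -> B) : Prop :=
  forall i : int, factor y (start f x i) (size (f (x i))) = f (x i).

Definition recognizable (f : A -> seq B) (Y : set (int -> A)) : Prop :=
  forall (x x' : int -> A) (y y' : int -> B) (k l : nat),
    Y x -> Y x' -> sigmaZ f x y -> sigmaZ f x' y' ->
    (k < size (f (x 1%R)))%N -> (l < size (f (x' 1%R)))%N ->
    (forall i : int, y (i + k%:Z)%R = y' (i + l%:Z)%R) ->
    x = x' /\ k = l.

End Recog.

Section Transfer.
Variables (A B : finType) (a0 : A) (b0 : B) (f : A -> seq B).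

(* A_sigma = { a(k) : 1 <= k <= |f a| }  (k stored 0-based) *)
Definition tletter := {a : A & 'I_(size (f a))}.

Definition alpha (t : tletter) : B := nth b0 (f (tag t)) (tagged t).

Definition pi_letter (a : A) : seq tletter :=
  [seq Tagged (fun a => 'I_(size (f a))) i | i <- enum 'I_(size (f a))].

Definition pi_word (u : seq A) : seq tletter := subst pi_letter u.

Definition hat_ex (w : seq tletter) (n : nat) : bool :=
  [exists t : n.-tuple A, infix w (pi_word t)].

Definition hat (w : seq tletter) : option (seq A) :=
  match pselect (exists n, hat_ex w n) with
  | left h => omap (fun t => val t)
                [pick t : (ex_minn h).-tuple A | infix w (pi_word t)]
  | right _ => None
  end.

Definition hat_meas (R : realType) (mu : {measure set (shspace a0) -> \bar R})
  (w : seq tletter) : \bar R :=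
  match hat w with Some u => mu (cyl a0 u) | None => 0%E end.

(* nu = f^M(mu), determined by its values on (nonempty) cylinders *)
Definition transfer (R : realType) (mu : {measure set (shspace a0) -> \bar R})
  (nu : {measure set (shspace b0) -> \bar R}) : Prop :=
  forall w' : seq B, w' != [::] ->
    nu (cyl b0 w') =
    (\sum_(t : (size w').-tuple tletter | map alpha t == w') hat_meas mu t)%E.

End Transfer.
Arguments transfer {A B} a0 b0 f {R} mu nu.

Section Directive.
Unset Implicit Arguments.
Variables (A : nat -> finType) (a0 : forall n, A n)
  (sigma : forall n, A n.+1 -> seq (A n)).

Definition non_erasing_seq : Prop := forall n, non_erasing (sigma n).

Fixpoint sigma_to (k j : nat) : A (j + k)%N -> seq (A k) :=
  match j return A (j + k)%N -> seq (A k) with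
  | 0 => fun a => [:: a]
  | j'.+1 => fun a => subst (sigma_to k j') (sigma (j' + k)%N a)
  end.

Fixpoint sig0 (n : nat) : A n -> seq (A 0%N) :=
  match n return A n -> seq (A 0%N) with
  | 0 => fun a => [:: a]
  | m.+1 => fun a => subst (sig0 m) (sigma m a)
  end.

Definition everywhere_growing : Prop :=
  forall M : nat, exists N : nat, forall n, (N <= n)%N ->
    forall a : A n, (M <= size (sig0 n a))%N.

Definition lang (k : nat) (u : seq (A k)) : Prop :=
  exists (j : nat) (a : A (j + k)%N), infix u (sigma_to k j a).

Definition X (k : nat) : set (int -> A k) :=
  [set x | forall (i : int) (n : nat), lang k (factor x i n)].

Definition totally_recognizable : Prop :=
  forall n, recognizable (sigma n) (X n.+1).

Definition vtower (R : realType) (v : forall n, A n -> R) : Prop :=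
  (forall n a, (0 <= v n a)%R) /\
  (forall n (b : A n),
     v n b = (\sum_(a : A n.+1) (count_mem b (sigma n a))%:R * v n.+1 a)%R).

Definition m_rel (R : realType) (v : forall n, A n -> R)
  (mu : {measure set (shspace (a0 0%N)) -> \bar R}) : Prop :=
  forall w : seq (A 0%N),
    (fun n : nat => ((\sum_(a : A n) v n a * (occ w (sig0 n a))%:R)%R)%:E)
      @ \oo --> mu (cyl (a0 0%N) w).

Definition mtower (R : realType)
  (mu : forall n, {measure set (shspace (a0 n)) -> \bar R}) : Prop :=
  (forall n, inv_fin_measure (mu n)) /\
  (forall n, transfer (a0 n.+1) (a0 n) (sigma n) (mu n.+1) (mu n)).

Definition zeta (R : realType)
  (mu : forall n, {measure set (shspace (a0 n)) -> \bar R}) : forall n, A n -> R :=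
  fun n a => fine (mu n (cyl (a0 n) [:: a])).

End Directive.
Arguments non_erasing_seq {A} sigma.
Arguments sigma_to {A} sigma k j.
Arguments sig0 {A} sigma n.
Arguments everywhere_growing {A} sigma.
Arguments lang {A} sigma k u.
Arguments X {A} sigma k.
Arguments totally_recognizable {A} sigma.
Arguments vtower {A} sigma {R} v.
Arguments m_rel {A} a0 sigma {R} v mu.
Arguments mtower {A a0} sigma {R} mu.
Arguments zeta {A a0 R} mu.
Set Implicit Arguments.

(* Main.v *)
Require Import Defs.
From HB Require Import structures.
From mathcomp Require Import all_boot all_order all_algebra.
From mathcomp Require Import all_classical all_reals all_analysis.
From mathcomp Require Import zify lra.
Import Order.TTheory GRing.Theory Num.Theory.
Import numFieldNormedType.Exports.
Set Implicit Arguments. Unset Strict Implicit. Unset Printing Implicit Defensive.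
Local Open Scope classical_set_scope.
Local Open Scope ring_scope.

(** For a non-erasing morphism [f], the transfer of a measure [mu] is the suspension
    [E |-> sum_a sum_(k < |f a|) mu {x | x_1 = a, T^k (f^Z x) in E}]; in this form it
    is functorial and makes sense for arbitrary set functions.  Up to an error of at
    most [(|w| + 1) mu(X)], it gives the cylinder of [w] the mass
    [sum_a mu[a] |f a|_w].  Along a tower the masses [mu_n(X_n)] tend to [0], because
    the morphisms are everywhere growing; hence every tower of transferred measures is
    automatically invariant, supported in the [X_n], and satisfies the defining limit
    of [m_sigma].

    A vector tower [v] is realized as such a tower by transferring down the atomic
    measures [sum_a v_n(a) delta_(aaa...)] and taking an ultrafilter limit in [n] on
    clopen sets, followed by Caratheodory extension.  If [f] is recognizable in a
    closed subshift [Y], a measure [mu] on [Y] is recovered from its transfer [nu] by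
    [mu E = nu (f^Z (E `&` Y))], the image of a clopen set being compact and hence
    measurable; and this formula defines a preimage of any [nu] carried by the shifts
    of [f^Z(Y)], which is the case for [Y = X_(n+1)] and [nu] on [X_n] by compactness. *)

Local Notation factor := Defs.factor.
Arguments Defs.factor : simpl never.

(** * Sequences, windows and local sets *)

(** All three bijections pass through one kind of object, a tower of finite measures linked by [op]
    ([optower]). Its letter masses form a vector tower, and its bottom measure is the value of
    m_sigma there. Injectivity of m_sigma is not read off from the limit formula: both vector towers
    are first realized by measures, the limit formula identifies the bottom measures, and
    recognizability propagates the equality upwards, where the vectors reappear as letter masses.
    Surjectivity climbs from a given measure on X one level at a time.

    In the realization, limits are needed at all levels at once and must stay compatible. One
    ultrafilter provides them on every clopen set of every level, and [op], being a finite sum on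
    clopen sets, commutes with them. The choice of ultrafilter leaves no trace, since the limit
    formula determines the result.

    The definition of the transfer by shortest covering words meets [op] only in [op_cyl];
    compositions of morphisms are then handled by [op_comp]. *)

Definition sh (B : Type) (k : int) (x : int -> B) : int -> B := fun i => x (i + k).

Definition agree (B : Type) (n : nat) (x y : int -> B) : Prop :=
  forall i : int, (absz i <= n)%N -> x i = y i.

(* Local sets are the clopen subsets of the shift space. *)
Definition local (B : Type) (E : set (int -> B)) : Prop :=
  exists n, forall x y, agree n x y -> E x -> E y.

Section Words.
Variable B : finType.
Implicit Types (x y : int -> B) (E : set (int -> B)).

Lemma shD k l x : sh k (sh l x) = sh (k + l) x.
Proof. by apply/funext => i; rewrite /sh addrA. Qed.

Lemma sh0 x : sh 0 x = x.
Proof. by apply/funext => i; rewrite /sh addr0. Qed.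

Lemma shK k x : sh (- k) (sh k x) = x.
Proof. by rewrite shD addNr sh0. Qed.

Lemma shNK k x : sh k (sh (- k) x) = x.
Proof. by rewrite shD addrN sh0. Qed.

Lemma size_factor x i n : size (factor x i n) = n.
Proof. by rewrite /factor size_map size_iota. Qed.

Lemma nth_factor d x i n j : (j < n)%N -> nth d (factor x i n) j = x (i + j%:Z).
Proof. by move=> jn; rewrite /factor (nth_map 0%N) ?size_iota// nth_iota. Qed.

Lemma factorP x i (w : seq B) d :
  factor x i (size w) = w <->
  forall j, (j < size w)%N -> x (i + j%:Z) = nth d w j.
Proof.
split=> [<- j|h].
  by rewrite size_factor => jw; rewrite nth_factor.
apply: (@eq_from_nth _ d); rewrite size_factor// => j jw.
by rewrite nth_factor// h.
Qed.

Lemma factor_eqP x y i i' n :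
  factor x i n = factor y i' n <->
  forall j, (j < n)%N -> x (i + j%:Z) = y (i' + j%:Z).
Proof.
split=> [h j jn|h].
  by rewrite -(nth_factor (x i) x i jn) h nth_factor.
apply: (@eq_from_nth _ (x i)); rewrite !size_factor// => j jn.
by rewrite !nth_factor// h.
Qed.

Lemma factor_cat x i m n :
  factor x i (m + n) = factor x i m ++ factor x (i + m%:Z) n.
Proof.
rewrite /factor iotaD map_cat; congr (_ ++ _).
rewrite -[X in iota X _]addn0 iotaDl -map_comp.
by apply: eq_map => j /=; rewrite PoszD addrA.
Qed.

Lemma factor_sh k x i n : factor (sh k x) i n = factor x (i + k) n.
Proof. by apply/factor_eqP => j _; rewrite /sh; congr x; lia. Qed.

Lemma factor1 x i : factor x i 1 = [:: x i].
Proof. by rewrite /factor /= addr0. Qed.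

Lemma factorS x i n : factor x i n.+1 = x i :: factor x (i + 1) n.
Proof. by rewrite -add1n factor_cat factor1. Qed.

Lemma factorSr x i n : factor x i n.+1 = rcons (factor x i n) (x (i + n%:Z)).
Proof. by rewrite -addn1 factor_cat factor1 cats1. Qed.

Lemma infix_factor x i n j m : j <= i -> i + n%:Z <= j + m%:Z ->
  infix (factor x i n) (factor x j m).
Proof.
move=> ji ijnm; pose p := absz (i - j).
have -> : m = (p + (n + (m - n - p)))%N by rewrite /p; lia.
rewrite factor_cat factor_cat; have -> : j + p%:Z = i by rewrite /p; lia.
exact: infix_infix.
Qed.

Lemma agreeS m n x y : (m <= n)%N -> agree n x y -> agree m x y.
Proof. by move=> mn h i im; apply: h; exact: leq_trans mn. Qed.

Lemma agreeC n x y : agree n x y -> agree n y x.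
Proof. by move=> h i im; rewrite h. Qed.

Lemma agree_factorP n x y :
  agree n x y <-> factor x (- n%:Z) n.*2.+1 = factor y (- n%:Z) n.*2.+1.
Proof.
rewrite factor_eqP; split=> [h j jn|h i iN]; first by apply: h; lia.
have /h : (absz (i + n%:Z)%R < n.*2.+1)%N by lia.
have -> // : (- n%:Z + absz (i + n%:Z)) = i by lia.
Qed.

Lemma localT : local [set: int -> B].
Proof. by exists 0%N. Qed.

Lemma local0 : local (@set0 (int -> B)).
Proof. by exists 0%N. Qed.

Lemma localC E : local E -> local (~` E).
Proof.
by move=> [n h]; exists n => x y xy nEx Ey; apply/nEx/(h y) => //; exact: agreeC.
Qed.

Lemma localI E F : local E -> local F -> local (E `&` F).
Proof.
move=> [n hE] [m hF]; exists (maxn n m) => x y xy [Ex Fx]; split.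
  by apply: hE Ex; apply: agreeS xy; rewrite leq_maxl.
by apply: hF Fx; apply: agreeS xy; rewrite leq_maxr.
Qed.

Lemma localU E F : local E -> local F -> local (E `|` F).
Proof.
by move=> lE lF; rewrite -[_ `|` _]setCK setCU; apply/localC/localI; exact: localC.
Qed.

Lemma local_coord (P : set B) i : local [set x | P (x i)].
Proof. by exists (absz i) => x y xy /=; rewrite xy. Qed.

Lemma local_factor i n (P : set (seq B)) : local [set x | P (factor x i n)].
Proof.
exists (absz i + n)%N => x y xy /=; suff -> : factor x i n = factor y i n by [].
by apply/factor_eqP => j jn; apply: xy; lia.
Qed.

Lemma local_sh k E : local E -> local (sh k @^-1` E).
Proof.
move=> [n h]; exists (n + absz k)%N => x y xy; apply: h => i iN.
by apply: xy; lia.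
Qed.

(* A diagonal subsequence, obtained from an ultrafilter. *)
Lemma seq_compact (x : nat -> int -> B) :
  exists y, forall n, exists2 N, (n <= N)%N & agree n (x N) y.
Proof.
have [U [UU sU]] := @ultraFilterLemma nat \oo _.
have ex i : exists b, U [set N | x N i = b].
  apply: contrapT => /forallNP h.
  have : U [set N | x N i \notin enum B].
    elim: (enum B) => [|b s IH]; first exact: filterE.
    have hb : U (~` [set N | x N i = b]) by case: (in_ultra_setVsetC [set N | x N i = b] UU) (h b).
    apply: filterS2 hb IH => N /= /eqP nb ns.
    by rewrite inE negb_or nb.
  by move=> /filter_ex[N] /=; rewrite mem_enum.
have [y hy] := choice ex; exists y => n.
have UA : U [set N | agree n (x N) y].
  suff : forall s : seq int, U [set N | forall i, i \in s -> x N i = y i].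
    move=> /(_ [seq i%:Z - n%:Z | i <- iota 0 n.*2.+1]).
    apply: filterS => N h i iN; apply: h.
    apply/mapP; exists (absz (i + n%:Z)); rewrite ?mem_iota; lia.
  elim=> [|i s IH]; first by apply: filterE.
  by apply: filterS2 (hy i) IH => N /= hi hs j; rewrite inE => /orP[/eqP->//|/hs].
have Un : U [set N | (n <= N)%N] by apply: sU; exists n.
by have [N [nN a]] := filter_ex (filterI Un UA); exists N.
Qed.

(** Otherwise each n yields a point of E outside the first n sets. A limit point stays in the local
    set E, hence lies in some F_i; as F_i is local too, it contains points of the sequence with
    index above i. *)
Lemma local_compact E (F : nat -> set (int -> B)) :
  local E -> (forall n, local (F n)) -> E `<=` \bigcup_n F n ->
  exists n, E `<=` \big[setU/set0]_(i < n) F i.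
Proof.
move=> [m hE] lF sEF; apply: contrapT => /forallNP h.
have /choice[x hx] : forall n, exists x, E x /\ forall i, (i < n)%N -> ~ F i x.
  move=> n; have /existsNP[x /not_implyP[Ex nx]] := h n; exists x; split=> // i ni Fi.
  by apply: nx; rewrite -bigcup_mkord; exists i.
have [y hy] := seq_compact x.
have Ey : E y by have [N _ a] := hy m; apply: hE a _; exact: (hx N).1.
have [i _ Fiy] := sEF _ Ey; have [k hF] := lF i.
have [N kN a] := hy (maxn k i.+1).
have /(_ i) := (hx N).2; case; first exact: leq_trans (leq_maxr _ _) kN.
by apply: hF Fiy; apply/agreeC; apply: agreeS a; rewrite leq_maxl.
Qed.

End Words.

(** * Finite measures on the shift space *)

(* Sequential closedness, the approximating sequence having a prescribed rate. *)
Definition sclosed (B : Type) (K : set (int -> B)) : Prop :=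
  forall (x : nat -> int -> B) y,
    (forall n, K (x n)) -> (forall n, agree n (x n) y) -> K y.

Section Measurability.
Variables (B : finType) (b0 : B).
Local Notation S := (shspace b0).
Implicit Types (x y : int -> B) (E : set (int -> B)).

Lemma local_measurable E : local E -> measurable (E : set S).
Proof.
move=> [n hE].
have -> : E = \bigcup_(w in [set w : n.*2.+1.-tuple B |
                exists2 x, E x & factor x (- n%:Z) n.*2.+1 = w]) @gcyl B b0 (- n%:Z) w.
  apply/seteqP; split=> [x Ex|x [w [y Ey yw]]].
    have s : size (factor x (- n%:Z) n.*2.+1) == n.*2.+1 by rewrite size_factor.
    exists (Tuple s); first by exists x.
    by rewrite /gcyl /mkset size_tuple.
  rewrite /gcyl /= size_tuple -yw => h; apply: hE Ey.
  by apply/agree_factorP; rewrite h.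
apply: fin_bigcup_measurable; first exact: finite_finset.
by move=> w _; apply: sub_sigma_algebra; exists (- n%:Z), w.
Qed.

Lemma measurable_sigma_local : (@measurable _ S) = <<s @local B >>.
Proof.
apply/seteqP; split.
  apply: smallest_sub; first exact: smallest_sigma_algebra.
  move=> _ [i [w ->]]; apply: sub_sigma_algebra.
  exact: (local_factor _ _ [set u | u = w]).
apply: smallest_sub; first exact: smallest_sigma_algebra.
exact: local_measurable.
Qed.

(** K is the intersection of its clopen neighbourhoods given by the windows [-n, n]; a point in all
    of them has approximations at exactly the rate that [sclosed] prescribes. *)
Lemma sclosed_measurable (K : set (int -> B)) : sclosed K -> measurable (K : set S).
Proof.
move=> cK.
have -> : K = \bigcap_n [set y | exists2 x, K x & agree n x y].
  apply/seteqP; split=> [y Ky n _|y hy]; first by exists y.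
  have /choice[x hx] : forall n, exists x, K x /\ agree n x y.
    by move=> n; have [x] := hy n I; exists x.
  by apply: (cK x) => n; have [] := hx n.
apply: bigcapT_measurable => n; apply: local_measurable.
exists n => y z yz [x Kx xy]; exists x => // i iN.
by rewrite xy// yz.
Qed.

End Measurability.

Lemma measurable_preimage_local (A B : finType) (a0 : A) (b0 : B)
    (g : (int -> A) -> int -> B) :
  (forall E, local E -> local (g @^-1` E)) ->
  forall E, measurable (E : set (shspace b0)) ->
    measurable (g @^-1` E : set (shspace a0)).
Proof.
move=> hg E; rewrite measurable_sigma_local => mE.
have := @smallest_sub _ (sigma_algebra setT) (@local B)
  [set E | measurable (g @^-1` E : set (shspace a0))].
apply=> //.
- split=> [|F mF|F mF] /=.
  + by rewrite preimage_set0.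
  + by rewrite setTD preimage_setC; exact: measurableC.
  + by rewrite preimage_bigcup; exact: bigcupT_measurable.
- by move=> F lF /=; apply: local_measurable; exact: hg.
Qed.

Section Measures.
Variables (R : realType) (B : finType) (b0 : B).
Local Notation S := (shspace b0).
Implicit Types (mu nu : {measure set S -> \bar R}) (E : set S).

Lemma measurable_sh k E : measurable E -> measurable (sh k @^-1` E : set S).
Proof. by apply: measurable_preimage_local => F; exact: local_sh. Qed.

Lemma measure_sum mu (I : finType) (G : I -> set S) E :
  measurable E -> (forall i, measurable (G i)) ->
  (forall i j x, E x -> G i x -> G j x -> i = j) ->
  (forall x, E x -> exists i, G i x) ->
  mu E = (\sum_(i : I) mu (E `&` G i))%E.
Proof.
move=> mE mG dG cG.
have {1}-> : E = \bigcup_(i in [set` enum I]) (E `&` G i).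
  apply/seteqP; split=> [x Ex|x [i _ []//]].
  by have [i Gi] := cG x Ex; exists i => //=; rewrite mem_enum.
rewrite measure_fin_bigcup.
- by rewrite -fsbig_seq ?enum_uniq// big_enum.
- exact: finite_finset.
- by move=> i j _ _ [x [[Ex Gi] [_ Gj]]]; exact: dG Ex Gi Gj.
- by move=> i _; exact: measurableI.
Qed.

Lemma meq_local mu nu : (mu setT < +oo)%E ->
  (forall E, local E -> mu E = nu E) -> meq mu nu.
Proof.
move=> fmu h E mE.
apply: (measure_unique (@local B : set (set S)) (fun=> setT)) => //.
- exact: measurable_sigma_local.
- by move=> F G; exact: localI.
- by move=> _; exact: localT.
- by apply/seteqP; split=> // x _; exists 0%N.
Qed.

Lemma inv_sh mu : shift_invariant mu ->
  forall (k : int) E, measurable E -> mu (sh k @^-1` E) = mu E.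
Proof.
move=> imu.
have nat_case (n : nat) E : measurable E -> mu (sh n%:Z @^-1` E) = mu E.
  elim: n E => [|n IH] E mE.
    congr (mu _); apply/seteqP; split=> x /=; rewrite sh0//.
  rewrite -[RHS]imu// -[RHS]IH; last exact: (@measurable_sh 1).
  have e (x : S) : @Defs.shift B b0 (sh n%:Z x) = sh n.+1%:Z x.
    by apply/funext => i; rewrite /Defs.shift /sh; congr x; lia.
  by congr (mu _); apply/seteqP; split=> x /=; rewrite e.
move=> k E mE; case: (intP k) => [|n|n]; first exact: nat_case.
  exact: nat_case.
rewrite -[LHS](nat_case n.+1); last exact: measurable_sh.
by congr (mu _); apply/seteqP; split=> x /=; rewrite shK.
Qed.

(** A local set is a finite union of cylinders on [-n, n], which invariance moves to position 1.
    Their words have length 2n + 1, so the empty word, on which [transfer] is silent, never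
    enters. *)
Lemma meq_cyl mu nu : inv_fin_measure mu -> inv_fin_measure nu ->
  (forall w, w != [::] -> mu (cyl b0 w) = nu (cyl b0 w)) -> meq mu nu.
Proof.
move=> [fmu imu] [fnu inu] h; apply: meq_local => // E lE.
have [n hE] := lE.
pose G (w : n.*2.+1.-tuple B) : set S := @gcyl B b0 (- n%:Z) w.
have mE : measurable E := local_measurable lE.
have mG w : measurable (G w) by apply: sub_sigma_algebra; exists (- n%:Z), w.
have dG i j x : E x -> G i x -> G j x -> i = j.
  by move=> _; rewrite /G/gcyl /= !size_tuple => e1 e2; apply: val_inj; exact: etrans (esym e1) e2.
have cG x : E x -> exists i, G i x.
  move=> _; have s : size (factor x (- n%:Z) n.*2.+1) == n.*2.+1 by rewrite size_factor.
  by exists (Tuple s); rewrite /G/gcyl /mkset size_tuple.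
rewrite (measure_sum mu mE mG dG cG) (measure_sum nu mE mG dG cG).
apply: eq_bigr => w _.
have [[x [Ex Gx]]|/forallNP h0] := pselect (exists x, (E `&` G w) x); last first.
  by have -> : E `&` G w = set0; [apply/seteqP; split=> // x /h0 | rewrite !measure0].
have -> : E `&` G w = sh (- n%:Z - 1) @^-1` (cyl b0 w).
  apply/seteqP; split=> [y [_]|y].
    by rewrite /G/cyl/gcyl/= factor_sh [1 + _]addrC subrK.
  rewrite /cyl/gcyl/= factor_sh [1 + _]addrC subrK => Gy; split=> //.
  apply: hE Ex; apply/agree_factorP; move: Gx Gy; rewrite /G/gcyl/= !size_tuple.
  by move=> -> ->.
have mc : measurable (cyl b0 w) by apply: sub_sigma_algebra; exists 1, w.
rewrite !inv_sh// h//.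
by rewrite -size_eq0 size_tuple.
Qed.

End Measures.

(** * Extension of additive set functions from the clopen sets *)

Section Premeasure.
Variables (B : finType) (b0 : B).

(** A copy of the shift space that carries the algebra of local sets, from which the outer measure
    is built; this algebra generates the sigma-algebra of [shspace]. *)
Definition clopen_space : Type := shsp b0.
HB.instance Definition _ := Pointed.copy clopen_space (shsp b0).
HB.instance Definition _ := isAlgebraOfSets.Build default_measure_display
  clopen_space (@local0 B) (@localU B) (@localC B).

(** Compactness supplies countable subadditivity: a countable cover of a clopen set by clopen sets
    has a finite subcover. *)
Lemma local_measure_extension (R : realType) (rho : set (int -> B) -> R) :
  (forall E, 0 <= rho E) ->
  (forall E F, local E -> local F -> E `&` F = set0 ->
     rho (E `|` F) = rho E + rho F) ->
  exists mu : {measure set (shspace b0) -> \bar R},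
    forall E, local E -> mu E = (rho E)%:E.
Proof.
move=> rho_ge0 rhoU; pose r (E : set clopen_space) : \bar R := (rho E)%:E.
have rho0 : rho set0 = 0.
  have := rhoU set0 set0 (@local0 B) (@local0 B); rewrite set0I setU0 => /(_ erefl).
  by move/eqP; rewrite -subr_eq0 opprD addNKr oppr_eq0 => /eqP.
have r_ge0 E : (0 <= r E)%E by rewrite lee_fin.
have r_add : measure_function.semi_additive r.
  rewrite additive2P; last by rewrite /r rho0.
  by move=> E F lE lF EF; rewrite /r -EFinD rhoU.
pose C := isContent.Build _ _ R r r_ge0 r_add.
pose c : {content set clopen_space -> \bar R} := HB.pack r C.
have c_sub : measurable_subset_sigma_subadditive c.
  move=> E F lF lE sEF.
  have [n sEn] := local_compact lE lF sEF.
  apply: (@le_trans _ _ (\sum_(i < n) c (F i))%E).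
    exact: content_subadditive.
  by rewrite -(big_mkord xpredT (fun i => c (F i))); exact: nneseries_lim_ge.
pose M := Content_SigmaSubAdditive_isMeasure.Build _ _ _ c c_sub.
pose m : {measure set clopen_space -> \bar R} := HB.pack (r : set _ -> \bar R) C M.
pose nu : {measure set _ -> \bar R} := measure_extension m.
have sm E : measurable (E : set (shspace b0)) ->
    measurable (E : set (g_sigma_algebraType (@measurable _ clopen_space))).
  by rewrite measurable_sigma_local.
pose nu' (E : set (shspace b0)) : \bar R := nu E.
have nu0 : nu' set0 = 0%E by exact: measure0.
have nuge0 E : (0 <= nu' E)%E by exact: measure_ge0.
have nuadd : semi_sigma_additive nu'.
  move=> F mF tF mUF; apply: (@measure_semi_sigma_additive _ _ _ nu F) => //.
    by move=> i; apply: sm.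
  exact: sm.
pose nm : {measure set (shspace b0) -> \bar R} :=
  HB.pack nu' (isMeasure.Build _ _ _ nu' nu0 nuge0 nuadd).
by exists nm => E lE; rewrite /= /nu' /nu /= /measure_extension measurable_mu_extE.
Qed.

End Premeasure.

(** * The map induced by a morphism on bi-infinite sequences *)

Lemma subst_cons (A B : Type) (f : A -> seq B) a w :
  subst f (a :: w) = f a ++ subst f w.
Proof. by []. Qed.

Lemma subst_cat (A B : Type) (f : A -> seq B) u w :
  subst f (u ++ w) = subst f u ++ subst f w.
Proof. by rewrite /subst map_cat flatten_cat. Qed.

Lemma subst_comp (A B C : Type) (f : B -> seq C) (g : A -> seq B) w :
  subst f (subst g w) = subst (fun a => subst f (g a)) w.
Proof. by elim: w => // a w IH; rewrite !subst_cons subst_cat IH. Qed.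

Lemma subst1 (A : Type) (w : seq A) : subst (fun a => [:: a]) w = w.
Proof. by elim: w => // a w IH; rewrite subst_cons IH. Qed.

Lemma size_subst_ge (A B : finType) (f : A -> seq B) w :
  non_erasing f -> (size w <= size (subst f w))%N.
Proof.
move=> ne; elim: w => // a w IH; rewrite subst_cons size_cat /=.
by rewrite -add1n leq_add.
Qed.

Lemma non_erasing_comp (A B C : finType) (f : B -> seq C) (g : A -> seq B) :
  non_erasing f -> non_erasing g -> non_erasing (fun a => subst f (g a)).
Proof. by move=> nf ng a; apply: leq_trans (size_subst_ge _ nf); exact: ng. Qed.

(** Based at 1 because [start] is normalized there: the block of the letter at 1 begins at position
    1. *)
Lemma int_ind1 (P : int -> Prop) :
  P 1 -> (forall i, P i <-> P (i + 1)) -> forall i, P i.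
Proof.
move=> P1 PS.
have up (n : nat) : P (1 + n%:Z).
  elim: n => [|n /PS]; first by rewrite addr0.
  by have -> : 1 + n%:Z + 1 = 1 + n.+1%:Z by lia.
have down (n : nat) : P (1 - n%:Z).
  elim: n => [|n h]; first by rewrite subr0.
  by apply/PS; have -> : 1 - n.+1%:Z + 1 = 1 - n%:Z by lia.
move=> i; have [i1|i1] := leP 1 i.
  by have -> : i = 1 + (absz (i - 1)%R)%:Z; [lia | exact: up].
by have -> : i = 1 - (absz (1 - i)%R)%:Z; [lia | exact: down].
Qed.

(** For non-erasing f and n = |p| + 1, the images of the letters at 1 - n, ..., n cover position p,
    so neither the default [b0] nor the absolute value affects the result. *)
Definition fZ (A B : finType) (b0 : B) (f : A -> seq B) (x : int -> A) : int -> B :=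
  fun p => let n := (absz p).+1 in
    nth b0 (subst f (factor x (1 - n%:Z) n.*2)) (absz (p - start f x (1 - n%:Z))%R).

Section BlockStarts.
Variables (A B : finType) (f : A -> seq B).
Implicit Types x : int -> A.

Lemma start1 x : start f x 1 = 1.
Proof. by rewrite /start /= big_ord0 addr0. Qed.

Lemma startS x i : start f x (i + 1) = start f x i + (size (f (x i)))%:Z.
Proof.
case: (intP i) => [|n|n].
- by rewrite add0r start1 /start ltxx absz0 big_ord_recl big_ord0 /= oppr0 addn0 subrK.
- rewrite /start; have -> : n.+1%:Z + 1 = n.+2%:Z by lia.
  by rewrite /= big_ord_recr /= PoszD addrA.
- rewrite /start; have -> : - n.+1%:Z + 1 = - n%:Z by lia.
  have -> : (0 < - n%:Z) = false by lia.
  have -> : (0 < - n.+1%:Z) = false by lia.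
  have -> : absz (- n%:Z)%R = n by lia.
  have -> : absz (- n.+1%:Z)%R = n.+1 by lia.
  by rewrite [in RHS]big_ord_recr /= PoszD; lia.
Qed.

Lemma start_factor x i n :
  start f x (i + n%:Z) = start f x i + (size (subst f (factor x i n)))%:Z.
Proof.
elim: n i => [|n IH] i; first by rewrite !addr0.
rewrite factorS subst_cons size_cat PoszD.
have -> : i + n.+1%:Z = i + 1 + n%:Z by lia.
by rewrite IH startS addrA.
Qed.

Lemma start_prefix x n :
  start f x (1 + n%:Z) = 1 + (size (subst f (factor x 1 n)))%:Z.
Proof. by rewrite start_factor start1. Qed.

Lemma start_sh k x i :
  start f (sh k x) i = start f x (i + k) - start f x (1 + k) + 1.
Proof.
move: i; apply: int_ind1 => [|i]; first by rewrite start1 subrr add0r.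
rewrite startS; have -> : i + 1 + k = i + k + 1 by lia.
by rewrite startS /sh; split; lia.
Qed.

End BlockStarts.

Section InducedMap.
Variables (A B : finType) (b0 : B) (f : A -> seq B).
Hypothesis ne : non_erasing f.
Implicit Types x : int -> A.
Local Notation F := (fZ b0 f).

Lemma start_ge x i n : start f x i + n%:Z <= start f x (i + n%:Z).
Proof.
rewrite start_factor lerD2l lez_nat.
by rewrite -{1}(size_factor x i n); exact: size_subst_ge.
Qed.

Lemma start_lt x (i j : int) : i < j -> start f x i + (size (f (x i)))%:Z <= start f x j.
Proof.
move=> ij; rewrite -startS; have -> : j = i + 1 + absz (j - i - 1)%R by lia.
by apply: le_trans (start_ge _ _ _); rewrite lerDl.
Qed.

Lemma start_cover x (p : int) : exists i q,
  [/\ (q < size (f (x i)))%N, p = start f x i + q%:Z & (absz i <= absz p + 1)%N].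
Proof.
pose n := (absz p).+1.
have lo : start f x (1 - n%:Z) <= p.
  by have := start_ge x (1 - n%:Z) n; rewrite subrK start1; lia.
have hi : p < start f x (1 - n%:Z + n.*2%:Z).
  have hn : p < 1 + n%:Z by rewrite /n; lia.
  have -> : 1 - n%:Z + n.*2%:Z = 1 + n%:Z by lia.
  by apply: lt_le_trans hn _; rewrite -{1}(start1 f x); exact: start_ge.
suff h m i : start f x i <= p -> p < start f x (i + m%:Z) ->
    exists j q, [/\ (q < size (f (x j)))%N, p = start f x j + q%:Z & i <= j < i + m%:Z].
  have [j [q [qf pE jb]]] := h _ _ lo hi; exists j, q; split=> //.
  by rewrite /n in jb; lia.
elim: m i => [|m IH] i loi hii; first by rewrite addr0 in hii; lia.
have [h|h] := ltP p (start f x (i + 1)).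
  exists i, (absz (p - start f x i)%R); rewrite startS in h; split; lia.
have [|j [q [qf pE jb]]] := IH (i + 1) h.
  by have -> : i + 1 + m%:Z = i + m.+1%:Z by lia.
by exists j, q; split=> //; lia.
Qed.

Lemma fZ_block x i q : (q < size (f (x i)))%N ->
  F x (start f x i + q%:Z) = nth b0 (f (x i)) q.
Proof.
move=> qf; rewrite /fZ; set p := _ + q%:Z; set n := (absz p).+1.
have lo : 1 - n%:Z <= i.
  rewrite leNgt; apply/negP => /(start_lt x).
  by have := start_ge x (1 - n%:Z) n; rewrite subrK start1 /n /p; lia.
have hi : i < 1 + n%:Z.
  rewrite ltNge; apply/negP => h; have := start_ge x 1 (absz (i - 1)%R).
  rewrite start1; have -> : 1 + (absz (i - 1)%R)%:Z = i by lia.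
  by rewrite /n /p in h *; lia.
pose k := absz (i - (1 - n%:Z))%R.
have -> : n.*2 = (k + (1 + (n.*2 - k - 1)))%N by rewrite /k; lia.
have iE : 1 - n%:Z + k%:Z = i by rewrite /k; lia.
rewrite factor_cat iE factor_cat factor1 !subst_cat.
have -> : absz (p - start f x (1 - n%:Z))%R = (size (subst f (factor x (1 - n%:Z) k)) + q)%N.
  by have := start_factor f x (1 - n%:Z) k; rewrite iE /p; lia.
rewrite nth_cat ltnNge leq_addr addKn /= nth_cat /subst /= cats0.
by rewrite qf.
Qed.

Lemma fZ_sigmaZ x : sigmaZ f x (F x).
Proof. by move=> i; apply/(factorP _ _ _ b0) => j jf; exact: fZ_block. Qed.

Lemma sigmaZ_uniq x y : sigmaZ f x y -> y = F x.
Proof.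
move=> h; apply/funext => p; have [i [q [qf -> _]]] := start_cover x p.
by rewrite fZ_block//; apply: (factorP _ _ _ b0).1.
Qed.

Lemma fZ_subst x i n :
  factor (F x) (start f x i) (size (subst f (factor x i n))) = subst f (factor x i n).
Proof.
elim: n i => [|n IH] i //.
by rewrite factorS subst_cons size_cat factor_cat -startS IH fZ_sigmaZ.
Qed.

Lemma fZ_sh k x : F (sh k x) = sh (start f x (1 + k) - 1) (F x).
Proof.
apply/funext => p; have [i [q [qf -> _]]] := start_cover (sh k x) p.
rewrite fZ_block// /sh start_sh -fZ_block//.
by congr fZ; lia.
Qed.

Lemma fZ_sh1 x : F (sh 1 x) = sh (size (f (x 1%R)))%:Z (F x).
Proof. by rewrite fZ_sh startS start1 addrAC subrr add0r. Qed.

Lemma fZ_agree n x y : agree n.+1 x y -> agree n (F x) (F y).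
Proof.
move=> xy p pn; rewrite /fZ; set m := (absz p).+1.
have E : factor x (1 - m%:Z) m.*2 = factor y (1 - m%:Z) m.*2.
  by apply/factor_eqP => j jm; apply: xy; rewrite /m in jm *; lia.
(* Block 1 starts at 1, so the start of block 1 - m depends only on the m letters at 1 - m, ...,
   0. *)
have E' : factor x (1 - m%:Z) m = factor y (1 - m%:Z) m.
  by apply/factor_eqP => j jm; apply: xy; rewrite /m in jm *; lia.
rewrite E; congr (nth _ _ (absz (p - _)%R)).
have := start_factor f x (1 - m%:Z) m; have := start_factor f y (1 - m%:Z) m.
by rewrite subrK !start1 E'; lia.
Qed.

Lemma fZ_local E : local E -> local (F @^-1` E).
Proof. by move=> [n h]; exists n.+1 => x y xy; apply: h; exact: fZ_agree. Qed.

End InducedMap.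

(** Block i of the composite begins where f places the start of block i of g; uniqueness of the
    image sequence then identifies both sides. *)
Lemma fZ_comp (A B C : finType) (b0 : B) (c0 : C) (f : B -> seq C)
    (g : A -> seq B) (x : int -> A) : non_erasing f -> non_erasing g ->
  fZ c0 f (fZ b0 g x) = fZ c0 (fun a => subst f (g a)) x.
Proof.
move=> nf ng; apply: sigmaZ_uniq; first exact: non_erasing_comp.
have gx i := fZ_sigmaZ b0 ng x i.
have startE : forall i,
    start (fun a => subst f (g a)) x i = start f (fZ b0 g x) (start g x i).
  apply: int_ind1 => [|i]; first by rewrite !start1.
  by rewrite !startS start_factor gx; split; lia.
by move=> i; rewrite startE -(gx i); exact: fZ_subst.
Qed.

Lemma fZ_sh_prefix (A B : finType) (b0 : B) (f : A -> seq B) n (x : int -> A) :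
  non_erasing f ->
  fZ b0 f (sh n%:Z x) = sh (size (subst f (factor x 1 n)))%:Z (fZ b0 f x).
Proof. by move=> ne; rewrite fZ_sh// start_prefix addrAC subrr add0r. Qed.

(** * Transferring set functions along a morphism *)

Definition letter_set (A : Type) (a : A) : set (int -> A) := [set x | x 1 = a].

Definition fm (R : realType) (B : finType) (b0 : B)
  (mu : {measure set (shspace b0) -> \bar R}) (E : set (int -> B)) : R := fine (mu E).

(* The measure transfer, written as the mass of the suspension of [x] under the
   roof function [size (f (x 1%R))]; it is meaningful for any set function. *)
Definition op (R : realType) (A B : finType) (b0 : B) (f : A -> seq B)
    (m : set (int -> A) -> R) (E : set (int -> B)) : R :=
  \sum_(a : A) \sum_(k < size (f a))
    m (letter_set a `&` [set x | E (sh k%:Z (fZ b0 f x))]).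

Section FiniteMeasures.
Variables (R : realType) (B : finType) (b0 : B).
Local Notation S := (shspace b0).
Variable mu : {measure set S -> \bar R}.
Hypothesis fmu : (mu setT < +oo)%E.
Implicit Types E F N : set S.

Lemma fmE E : measurable E -> mu E = (fm mu E)%:E.
Proof.
move=> mE; rewrite /fm fineK// ge0_fin_numE//.
by apply: le_lt_trans fmu; apply: le_measure; rewrite ?inE.
Qed.

Lemma fm_ge0 E : 0 <= fm mu E.
Proof. exact: fine_ge0. Qed.

Lemma fm0 : fm mu set0 = 0.
Proof. by rewrite /fm measure0. Qed.

Lemma fm_le E F : measurable E -> measurable F -> E `<=` F -> fm mu E <= fm mu F.
Proof.
by move=> mE mF EF; rewrite -lee_fin -!fmE//; apply: le_measure; rewrite ?inE.
Qed.

Lemma fm_sum (I : finType) (G : I -> set S) E :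
  measurable E -> (forall i, measurable (G i)) ->
  (forall i j x, E x -> G i x -> G j x -> i = j) ->
  (forall x, E x -> exists i, G i x) ->
  fm mu E = \sum_(i : I) fm mu (E `&` G i).
Proof.
move=> mE mG dG cG; apply: EFin_inj; rewrite -fmE// (measure_sum mu mE mG dG cG).
by rewrite -sumEFin; apply: eq_bigr => i _; rewrite fmE//; exact: measurableI.
Qed.

Lemma fm_null N E F : measurable N -> mu N = 0%E -> measurable E -> measurable F ->
  (forall x, ~ N x -> E x -> F x) -> fm mu E <= fm mu F.
Proof.
move=> mN N0 mE mF h; rewrite -lee_fin -!fmE//.
apply: (@le_trans _ _ (mu (F `|` N))).
  apply: le_measure; rewrite ?inE//; first exact: measurableU.
  by move=> x Ex; have [Nx|Nx] := pselect (N x); [right|left; exact: h].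
by rewrite measureU0.
Qed.

Lemma eq_fm_null N E F : measurable N -> mu N = 0%E -> measurable E -> measurable F ->
  (forall x, ~ N x -> E x <-> F x) -> fm mu E = fm mu F.
Proof.
move=> mN N0 mE mF h; apply/eqP; rewrite eq_le; apply/andP; split.
  by apply: (fm_null mN) => // x Nx; exact: (h x Nx).1.
by apply: (fm_null mN) => // x Nx; exact: (h x Nx).2.
Qed.

Lemma local_letter_set (a : B) : local (letter_set a).
Proof. exact: (local_coord [set b | b = a] 1). Qed.

Lemma measurable_letter_set (a : B) : measurable (letter_set a : set S).
Proof. apply: local_measurable; exact: local_letter_set. Qed.

Lemma fm_letters E : measurable E -> fm mu E = \sum_(a : B) fm mu (letter_set a `&` E).
Proof.
move=> mE; rewrite (@fm_sum _ (@letter_set B) E)//.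
- by apply: eq_bigr => a _; rewrite setIC.
- by move=> a; exact: measurable_letter_set.
- by move=> a b x _ <- <-.
- by move=> x _; exists (x 1).
Qed.

Lemma fm_lettersT : fm mu setT = \sum_(a : B) fm mu (letter_set a).
Proof. by rewrite fm_letters//; apply: eq_bigr => a _; rewrite setIT. Qed.

Lemma cyl_letter_set (b : B) : cyl b0 [:: b] = letter_set b.
Proof.
by apply/seteqP; split=> x; rewrite /cyl/gcyl/= factor1 /letter_set/=; [case|move=> ->].
Qed.

End FiniteMeasures.

Section Operator.
Variables (R : realType) (A B : finType) (a0 : A) (b0 : B) (f : A -> seq B).
Hypothesis ne : non_erasing f.
Implicit Types m : set (int -> A) -> R.

Lemma fZ_prefix (x : int -> A) k : (k < size (f (x 1%R)))%N ->
  fZ b0 f x (1 + k%:Z) = nth b0 (f (x 1%R)) k.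
Proof. by move=> kf; rewrite -{1}(start1 f x) fZ_block. Qed.

Lemma factor_fZ_prefix (x : int -> A) k n : (k + n <= size (f (x 1%R)))%N ->
  factor (fZ b0 f x) (1 + k%:Z) n = take n (drop k (f (x 1%R))).
Proof.
move=> kn; apply: (@eq_from_nth _ b0).
  by rewrite size_factor size_takel// size_drop; lia.
move=> j; rewrite size_factor => jn; rewrite nth_factor// nth_take// nth_drop.
by rewrite -addrA -PoszD fZ_prefix//; lia.
Qed.

Lemma measurable_fZ (E : set (shspace b0)) : measurable E ->
  measurable (fZ b0 f @^-1` E : set (shspace a0)).
Proof. by apply: measurable_preimage_local => F; exact: fZ_local. Qed.

Lemma measurable_op_set k (E : set (shspace b0)) : measurable E ->
  measurable ([set x | E (sh k (fZ b0 f x))] : set (shspace a0)).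
Proof. by move=> mE; exact: (measurable_fZ (measurable_sh k mE)). Qed.

Lemma measurable_op_setI a k (E : set (shspace b0)) : measurable E ->
  measurable (letter_set a `&` [set x | E (sh k (fZ b0 f x))] : set (shspace a0)).
Proof.
by move=> mE; apply: measurableI; [exact: measurable_letter_set|exact: measurable_op_set].
Qed.

(** On letters the operator acts as the incidence matrix M(f), which links measure towers to vector
    towers. *)
Lemma op_letter m (b : B) : m set0 = 0 ->
  op b0 f m (letter_set b) = \sum_(a : A) m (letter_set a) * (count_mem b (f a))%:R.
Proof.
move=> m0; apply: eq_bigr => a _.
rewrite -sum1_count [in RHS]big_mkcond [in RHS](big_nth b0) [in RHS]big_mkord natr_sum mulr_sumr.
apply: eq_bigr => k _; case: ifP => /eqP h.
  rewrite mulr1; congr m; apply/seteqP; split=> [x []//|x xa]; split=> //=.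
  by rewrite /letter_set/= /sh fZ_prefix xa.
rewrite mulr0 -[RHS]m0; congr m; apply/seteqP; split=> // x [xa].
by rewrite /letter_set/= /sh fZ_prefix xa.
Qed.

Lemma opT m : op b0 f m setT = \sum_(a : A) m (letter_set a) * (size (f a))%:R.
Proof.
apply: eq_bigr => a _; rewrite (eq_bigr (fun=> m (letter_set a))).
  by rewrite sumr_const card_ord mulr_natr.
by move=> k _; congr m; apply/seteqP; split=> [x []|x].
Qed.

Lemma op_ge0 m E : (forall F, 0 <= m F) -> 0 <= op b0 f m E.
Proof. by move=> m0; apply: sumr_ge0 => a _; exact: sumr_ge0. Qed.

Lemma op0 m : m set0 = 0 -> op b0 f m set0 = 0.
Proof.
move=> m0; apply: big1 => a _; apply: big1 => k _.
by rewrite -[RHS]m0; congr m; apply/seteqP; split=> // x [].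
Qed.

Lemma opU m E F : (forall E F, E `&` F = set0 -> m (E `|` F) = m E + m F) ->
  E `&` F = set0 -> op b0 f m (E `|` F) = op b0 f m E + op b0 f m F.
Proof.
move=> mU EF; rewrite /op -big_split; apply: eq_bigr => a _ /=.
rewrite -big_split; apply: eq_bigr => k _ /=; rewrite -mU.
  by rewrite -setIUr.
apply/seteqP; split=> // x [[_ Ex] [_ Fx]].
by have : (E `&` F) (sh (k : nat)%:Z (fZ b0 f x)) by []; rewrite EF.
Qed.

Lemma op_ext m m' E : measurable (E : set (shspace b0)) ->
  (forall F, measurable (F : set (shspace a0)) -> m F = m' F) ->
  op b0 f m E = op b0 f m' E.
Proof.
move=> mE h; apply: eq_bigr => a _; apply: eq_bigr => k _.
by apply: h; exact: measurable_op_setI.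
Qed.

Section FiniteMeasure.
Variable mu : {measure set (shspace a0) -> \bar R}.
Hypothesis fmu : (mu setT < +oo)%E.

(** The sums over k telescope: the shift carries floor k to floor k + 1. What remains is the bottom
    floor and the one just above the top, which belongs to the shifted base point because f^Z(T x)
    is f^Z(x) shifted by |f(x_1)|. *)
Lemma op_shift (E : set (shspace b0)) : measurable E ->
  op b0 f (fm mu) (sh 1 @^-1` E) + fm mu (fZ b0 f @^-1` E) =
  op b0 f (fm mu) E + fm mu (sh 1 @^-1` (fZ b0 f @^-1` E)).
Proof.
move=> mE.
have mF := measurable_fZ mE.
rewrite (fm_letters fmu mF) (fm_letters fmu (measurable_sh 1 mF)).
rewrite /op -!big_split; apply: eq_bigr => a _ /=.
pose G k := fm mu (letter_set a `&` [set x | E (sh k%:Z (fZ b0 f x))]).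
transitivity (\sum_(k < (size (f a)).+1) G k).
  rewrite big_ord_recl addrC; congr (_ + _).
    by rewrite /G; congr fm; congr (_ `&` _); apply/seteqP; split=> x /=; rewrite sh0.
  apply: eq_bigr => k _; rewrite /G; congr fm; congr (_ `&` _).
  have e : 1 + (k : nat)%:Z = (lift ord0 k)%:Z by rewrite /= /bump /=; lia.
  by apply/seteqP; split=> x /=; rewrite shD e.
rewrite big_ord_recr; congr (_ + _); rewrite /G; congr fm.
by apply/seteqP; split=> x [xa h]; split=> //; move: h; rewrite /= fZ_sh1// xa.
Qed.

Lemma op_inv (E : set (shspace b0)) : measurable E -> shift_invariant mu ->
  op b0 f (fm mu) (sh 1 @^-1` E) = op b0 f (fm mu) E.
Proof.
move=> mE imu; have := op_shift mE.
have mF := measurable_fZ mE.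
have -> : fm mu (sh 1 @^-1` (fZ b0 f @^-1` E)) = fm mu (fZ b0 f @^-1` E).
  by rewrite /fm inv_sh.
by move/addIr.
Qed.

Lemma op_shift_le (E : set (shspace b0)) : measurable E ->
  `|op b0 f (fm mu) (sh 1 @^-1` E) - op b0 f (fm mu) E| <= fm mu setT.
Proof.
move=> mE; have := op_shift mE.
have mF := measurable_fZ mE.
have := fm_ge0 mu (fZ b0 f @^-1` E).
have := fm_ge0 mu (sh 1 @^-1` (fZ b0 f @^-1` E)).
have := fm_le fmu mF measurableT (@subsetT _ _).
have := fm_le fmu (measurable_sh 1 mF) measurableT (@subsetT _ _).
by rewrite ler_norml; lra.
Qed.

Lemma op_measure : exists nu : {measure set (shspace b0) -> \bar R},
  (nu setT < +oo)%E /\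
  forall E : set (shspace b0), measurable E -> nu E = (op b0 f (fm mu) E)%:E.
Proof.
pose D a (k : 'I_(size (f a))) (E : set (shspace b0)) : set (shspace a0) :=
  letter_set a `&` [set x | E (sh k%:Z (fZ b0 f x))].
pose nu (E : set (shspace b0)) : \bar R := (\sum_(a : A) \sum_(k < size (f a)) mu (D a k E))%E.
have nu0 : nu set0 = 0%E.
  rewrite /nu big1// => a _; rewrite big1// => k _.
  have -> : D a k set0 = set0 by apply/seteqP; split=> // x [].
  exact: measure0.
have nuge0 E : (0 <= nu E)%E by apply: sume_ge0 => a _; apply: sume_ge0.
have nuadd : semi_sigma_additive nu.
  move=> F mF tF mUF; rewrite /nu.
  have -> : (fun n => (\sum_(0 <= i < n) \sum_(a : A) \sum_(k < size (f a)) mu (D a k (F i)))%E)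
    = (fun n => (\sum_(a : A) \sum_(k < size (f a)) \sum_(0 <= i < n) mu (D a k (F i)))%E).
    apply/funext => n; rewrite exchange_big; apply: eq_bigr => a _ /=.
    by rewrite exchange_big.
  apply: cvg_nnesum => [a _|a _].
    by near=> n; apply: sume_ge0 => k _; exact: sume_ge0.
  apply: cvg_nnesum => [k _|k _]; first by near=> n; exact: sume_ge0.
  have -> : D a k (\bigcup_n F n) = \bigcup_n D a k (F n).
    by apply/seteqP; split=> [x [xa [n _ Fn]]|x [n _ [xa Fn]]]; [exists n|split=> //; exists n].
  apply: measure_semi_sigma_additive => //.
  - by move=> i; exact: measurable_op_setI.
  - move=> i j _ _ [x [[_ Fi] [_ Fj]]]; apply: tF => //.
    by exists (sh k%:Z (fZ b0 f x)).
  - by apply: bigcupT_measurable => i; exact: measurable_op_setI.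
pose nm : {measure set (shspace b0) -> \bar R} :=
  HB.pack nu (isMeasure.Build _ _ _ nu nu0 nuge0 nuadd).
have nmE (E : set (shspace b0)) : measurable E -> nm E = (op b0 f (fm mu) E)%:E.
  move=> mE; rewrite /nm /= /nu /op -sumEFin; apply: eq_bigr => a _.
  rewrite -sumEFin; apply: eq_bigr => k _.
  by rewrite fmE//; exact: measurable_op_setI.
by exists nm; split=> //; rewrite nmE// ltry.
Unshelve. all: by end_near.
Qed.

(** At an offset k with k + |w| <= |f(a)| the word is read inside f(a), so its occurrence depends on
    a alone. Only the last offsets look beyond the block, each at a cost of at most mu[a]. *)
Lemma op_occ (w : seq B) :
  `|op b0 f (fm mu) (cyl b0 w) - \sum_(a : A) fm mu (letter_set a) * (occ w (f a))%:R|
  <= (size w).+1%:R * fm mu setT.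
Proof.
rewrite (fm_lettersT fmu) mulr_sumr /op -sumrB.
apply: le_trans (ler_norm_sum _ _ _) _; apply: ler_sum => a _.
set c := fm mu (letter_set a); set n := size (f a).
pose G k := fm mu (letter_set a `&` [set x | cyl b0 w (sh k%:Z (fZ b0 f x))]).
have mc : measurable (cyl b0 w : set (shspace b0)) by apply: sub_sigma_algebra; exists 1, w.
have G0 k : 0 <= G k by exact: fm_ge0.
have Gc k : G k <= c.
  by apply: fm_le => //; [exact: measurable_op_setI|exact: measurable_letter_set].
have c0 : 0 <= c by exact: fm_ge0.
pose mt k := take (size w) (drop k (f a)) == w.
have sumG N : 0 <= \sum_(k < N) G k <= N%:R * c.
  apply/andP; split; first exact: sumr_ge0.
  apply: (@le_trans _ _ (\sum_(k < N) c)); first exact: ler_sum.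
  by rewrite sumr_const card_ord mulr_natl.
rewrite -/(G _) (eq_bigr (fun k : 'I_n => G k))//.
have [wn|nw] := leqP (size w) n; last first.
  have -> : occ w (f a) = 0%N.
    (* The truncated difference leaves offset 0 to be tested; it fails because f(a) is shorter than
       w. *)
    rewrite /occ -/n; have -> : (n - size w = 0)%N by lia.
    rewrite /= drop0 take_oversize; last exact: ltnW.
    by case: eqP => // E; move: nw; rewrite -E ltnn.
  rewrite mulr0 subr0; have /andP[h1 h2] := sumG n.
  rewrite ger0_norm//; apply: le_trans h2 _; apply: ler_wpM2r => //.
  by rewrite ler_nat; lia.
have Gm k : (k + size w <= n)%N -> G k = c * (mt k)%:R.
  move=> kw; rewrite /G /c; have [e|e] := boolP (mt k).
    rewrite mulr1; congr fm; apply/seteqP; split=> [x []//|x xa]; split=> //=.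
    rewrite /cyl/gcyl/= factor_sh factor_fZ_prefix xa//; exact/eqP.
  rewrite mulr0 -[RHS](fm0 mu); congr fm; apply/seteqP; split=> // x [xa] /=.
  by rewrite /cyl/gcyl/= factor_sh factor_fZ_prefix xa// => /eqP; rewrite -/(mt k) (negPf e).
have -> : c * (occ w (f a))%:R = \sum_(k < (n - size w).+1) G k.
  rewrite /occ -sum1_count [in LHS]big_mkcond.
  rewrite -[iota 0%N _]/(index_iota 0%N (n - size w).+1) [in LHS]big_mkord.
  rewrite natr_sum mulr_sumr; apply: eq_bigr => k _.
  rewrite Gm; last by have := ltn_ord k; lia.
  by congr (_ * _); rewrite /mt; case: eqP.
(* [occ] tests |f(a)| - |w| + 1 offsets, which for the empty word is one more than the number of
   floors. The extra term [G n] compensates for this and accounts for the + 1 in the bound. *)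
have e : \sum_(k < n.+1) G k = \sum_(k < (n - size w).+1) G k
    + \sum_(k < size w) G ((n - size w).+1 + k)%N.
  have -> : n.+1 = ((n - size w).+1 + size w)%N by lia.
  by rewrite big_split_ord.
have h : 0 <= \sum_(k < size w) G ((n - size w).+1 + k)%N <= (size w)%:R * c.
  apply/andP; split; first exact: sumr_ge0.
  apply: (@le_trans _ _ (\sum_(k < size w) c)); first exact: ler_sum.
  by rewrite sumr_const card_ord mulr_natl.
rewrite big_ord_recr /= in e.
have := G0 n; have := Gc n; rewrite ler_norml -natr1 mulrDl mul1r.
by lra.
Qed.

End FiniteMeasure.
End Operator.

Lemma sum_subst (V : nmodType) (B C : finType) (b0 : B) (f : B -> seq C) (w : seq B)
    (G : nat -> V) :
  \sum_(j < size (subst f w)) G j =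
  \sum_(l < size w) \sum_(k < size (f (nth b0 w l))) G (size (subst f (take l w)) + k)%N.
Proof.
elim: w G => [|b w IH] G; first by rewrite !big_ord0.
rewrite subst_cons size_cat big_split_ord big_ord_recl /=; congr (_ + _).
rewrite (IH (fun j => G (size (f b) + j)%N)); apply: eq_bigr => l _.
by apply: eq_bigr => k _; rewrite subst_cons size_cat addnA.
Qed.

(** A floor j of the composite over a is an index l in g(a) with a floor k over the letter found
    there: j is k plus the length of the f-image of the first l letters. All other intermediate
    letters contribute the empty set. *)
Lemma op_comp (R : realType) (A B C : finType) (b0 : B) (c0 : C) (f : B -> seq C)
    (g : A -> seq B) (m : set (int -> A) -> R) E :
  non_erasing f -> non_erasing g -> m set0 = 0 ->
  op c0 f (op b0 g m) E = op c0 (fun a => subst f (g a)) m E.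
Proof.
move=> nf ng m0; rewrite /op.
pose Q a j := letter_set a `&` [set x | E (sh j%:Z (fZ c0 (fun a => subst f (g a)) x))].
have step a (l : 'I_(size (g a))) b k :
    m (letter_set a `&` [set x | (letter_set b `&`
         [set y | E (sh k%:Z (fZ c0 f y))]) (sh l%:Z (fZ b0 g x))]) =
    if b == nth b0 (g a) l then m (Q a (size (subst f (take l (g a))) + k)%N) else 0.
  have xE x : letter_set a x -> sh l%:Z (fZ b0 g x) 1 = nth b0 (g a) l.
    by move=> xa; rewrite /sh fZ_prefix// xa.
  have fE x : letter_set a x -> sh k%:Z (fZ c0 f (sh l%:Z (fZ b0 g x))) =
      sh (size (subst f (take l (g a))) + k)%N%:Z (fZ c0 (fun a => subst f (g a)) x).
    move=> xa; have fac : factor (fZ b0 g x) 1 l = take l (g a).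
      have := @factor_fZ_prefix _ _ b0 _ ng x 0%N l; rewrite xa addr0 drop0; apply.
      by rewrite add0n ltnW.
    by rewrite fZ_sh_prefix// shD fZ_comp// fac addnC PoszD.
  case: eqP => h.
    congr m; apply/seteqP; split=> [x [xa [_ Ex]]|x [xa Ex]].
      by split=> //; rewrite /mkset -fE.
    by split=> //; split; [rewrite /letter_set /mkset xE|rewrite /mkset fE].
  rewrite -[RHS]m0; congr m; apply/seteqP; split=> // x [xa [+ _]].
  by rewrite /letter_set /= xE// => /esym.
under eq_bigr do under eq_bigr do under eq_bigr do under eq_bigr do rewrite step.
under eq_bigr do rewrite exchange_big.
rewrite exchange_big /=; apply: eq_bigr => a _.
rewrite (sum_subst b0 f (g a) (fun j => m (Q a j))).
under eq_bigr do rewrite exchange_big /=.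
rewrite exchange_big /=; apply: eq_bigr => l _.
rewrite (bigD1 (nth b0 (g a) l)) //= [X in _ + X]big1 ?addr0.
  by apply: eq_bigr => k _; rewrite eqxx.
by move=> b /negPf h; apply: big1 => k _; rewrite h.
Qed.

(** * Measure transfer and the operator *)

Section Transfer.
Variables (A B : finType) (a0 : A) (b0 : B) (f : A -> seq B).
Hypothesis ne : non_erasing f.
Local Notation TL := ({a : A & 'I_(size (f a))} : finType).
Local Notation pi := (@pi_letter A B f : A -> seq TL).
Local Notation piw := (pi_word f : seq A -> seq TL).
Implicit Types (x : int -> A) (t : seq TL) (u : seq A).

Let t0 : TL := Tagged (fun a => 'I_(size (f a))) (Ordinal (ne a0)).

Local Notation piZ := (fZ t0 pi).

Lemma size_pi_letter a : size (pi a) = size (f a).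
Proof. by rewrite /pi_letter size_map size_enum_ord. Qed.

Lemma nth_pi_letter a (k : 'I_(size (f a))) :
  nth t0 (pi a) k = Tagged (fun a => 'I_(size (f a))) k.
Proof.
by rewrite /pi_letter (nth_map k) ?size_enum_ord// nth_ord_enum.
Qed.

Lemma pi_ne : non_erasing pi.
Proof. by move=> a; rewrite size_pi_letter. Qed.

Lemma start_pi x i : start pi x i = start f x i.
Proof.
move: i; apply: int_ind1 => [|i]; first by rewrite !start1.
by rewrite !startS size_pi_letter; split; lia.
Qed.

Lemma alpha_piZ x i : alpha b0 (piZ x i) = fZ b0 f x i.
Proof.
have [j [q [qf -> _]]] := start_cover ne x i.
rewrite -{1}start_pi !fZ_block ?size_pi_letter//; last exact: pi_ne.
by rewrite (nth_pi_letter (Ordinal qf)).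
Qed.

Lemma map_alpha_piZ x i n :
  map (@alpha A B b0 f) (factor (piZ x) i n) = factor (fZ b0 f x) i n.
Proof. by rewrite /Defs.factor -map_comp; apply: eq_map => j /=; rewrite alpha_piZ. Qed.

Lemma piZ_head x (s : TL) : x 1 = tag s -> piZ x (1 + (tagged s : nat)%:Z) = s.
Proof.
move=> xs; rewrite fZ_prefix; last 2 first.
- exact: pi_ne.
- by rewrite xs size_pi_letter.
by rewrite xs nth_pi_letter; case: (s).
Qed.

Lemma piZ_word x n :
  factor (piZ x) 1 (size (piw (factor x 1 n))) = piw (factor x 1 n).
Proof. by have := fZ_subst t0 pi_ne x 1 n; rewrite start1. Qed.

Lemma size_piw u : (size u <= size (piw u))%N.
Proof. exact: (size_subst_ge u pi_ne). Qed.

Lemma hat_some t u : hat t = Some u ->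
  infix t (piw u) /\ forall u', infix t (piw u') -> (size u <= size u')%N.
Proof.
rewrite /hat; case: pselect => // h; case: pickP => //= v tv [<-]; split=> // u' tu'.
rewrite size_tuple; case: ex_minnP => n _; apply.
by apply/existsP; exists (in_tuple u').
Qed.

Lemma hat_none t : hat t = None -> forall u, ~ infix t (piw u).
Proof.
rewrite /hat; case: pselect => [h|h _ u tu].
  case: pickP => //= hn _; case: ex_minnP hn => n /existsP[v tv] _ /(_ v).
  by rewrite tv.
by apply: h; exists (size u); apply/existsP; exists (in_tuple u).
Qed.

(* [s] stands for the first letter of [t]: it prescribes [x 1] and the offset of [t]. *)
Definition tower_set (s : TL) t : set (int -> A) :=
  letter_set (tag s) `&` [set x | factor (piZ x) (1 + (tagged s : nat)%:Z) (size t) = t].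

Lemma tower_set_infix s t x : tower_set s t x ->
  infix t (piw (factor x 1 (tagged s + size t))).
Proof.
move=> [_ /= xt]; set n := (_ + _)%N; rewrite -[X in infix X _]xt.
rewrite -piZ_word; apply: infix_factor; first by lia.
by have := size_piw (factor x 1 n); rewrite size_factor /n; lia.
Qed.

(** A letter of A_f records its source letter and its offset, so reading the word fixes every letter
    of x whose block it meets. By minimality of u these are exactly the letters of u: the occurrence
    begins in the first block and ends in the last. *)
Lemma tower_set_hat s t u : hat (s :: t) = Some u ->
  tower_set s (s :: t) = cyl a0 u.
Proof.
move=> /hat_some[/infixP[s1 [s2 E]] umin].
case: u E umin => [|c u] E umin; first by case: s1 E.
set w := s :: t in E *.
have Eu : piw (c :: u) = pi c ++ piw u by [].
(* If s1 covered the first block, dropping this block would leave a shorter word that still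
   works. *)
have s1c : (size s1 < size (pi c))%N.
  rewrite ltnNge; apply/negP => h; suff /umin : infix w (piw u) by rewrite /= ltnn.
  apply/infixP; exists (drop (size (pi c)) s1), s2.
  have -> : piw u = drop (size (pi c)) (piw (c :: u)) by rewrite Eu drop_size_cat.
  rewrite E drop_cat; case: ltnP => h1 //.
  by rewrite [drop _ s1]drop_oversize//; have -> : size (pi c) = size s1; [apply/eqP; rewrite eqn_leq h h1|rewrite subnn drop0].
have sE : s = nth t0 (pi c) (size s1).
  have := congr1 (fun v => nth t0 v (size s1)) E.
  by rewrite Eu !nth_cat s1c ltnn subnn.
have [sc sk] : tag s = c /\ (tagged s : nat) = size s1.
  rewrite size_pi_letter in s1c.
  by rewrite sE (nth_pi_letter (Ordinal s1c)).
set v := c :: u in E Eu umin *.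
(* If the occurrence ended before block j, the first j letters would suffice, against minimality. *)
have last_block j : (j < size v)%N -> (size (piw (take j v)) < size s1 + size w)%N.
  move=> jv; rewrite ltnNge; apply/negP => h.
  suff /umin : infix w (piw (take j v)) by rewrite size_takel ?(ltnW jv)// leqNgt jv.
  have Ej : piw v = piw (take j v) ++ piw (drop j v).
    by rewrite -[in LHS](cat_take_drop j v) /pi_word subst_cat.
  apply/infixP; exists s1, (drop (size s1 + size w) (piw (take j v))).
  have e1 : take (size s1 + size w) (piw v) = s1 ++ w.
    by rewrite E catA take_size_cat// size_cat.
  have e2 : take (size s1 + size w) (piw v) = take (size s1 + size w) (piw (take j v)).
    by rewrite Ej takel_cat.
  by rewrite catA -e1 e2 cat_take_drop.
apply/seteqP; split=> x.
  move=> [xs /= xw].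
  have pref j : (j <= size v)%N -> factor x 1 j = take j v.
    elim: j => [|j IH] jv; first by rewrite take0.
    have {}IH := IH (ltnW jv); rewrite factorSr IH (take_nth a0)//; congr (rcons _ _).
    set q := size (piw (take j v)).
    have sz : (0 < size (f (x (1 + j%:Z)%R)))%N by exact: ne.
    have sz' : (0 < size (f (nth a0 v j)))%N by exact: ne.
    have h1 : piZ x (1 + q%:Z) = nth t0 (pi (x (1 + j%:Z))) 0.
      have := @fZ_block _ _ t0 pi pi_ne x (1 + j%:Z) 0%N.
      by rewrite size_pi_letter addr0 start_prefix IH; apply.
    have h2 : nth t0 (piw v) q = nth t0 (pi (nth a0 v j)) 0.
      rewrite -{1}(cat_take_drop j v) (drop_nth a0)// /pi_word subst_cat subst_cons.
      by rewrite nth_cat ltnn subnn nth_cat size_pi_letter sz'.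
    have qp : (q < size s1 + size w)%N by exact: last_block.
    (* The first position of block j lies either in s1, hence in the first block, whose letter is
       known from s, or in the part read as w. *)
    have h3 : piZ x (1 + q%:Z) = nth t0 (piw v) q.
      rewrite E nth_cat; case: ltnP => qs.
        have -> : nth t0 s1 q = nth t0 (pi c) q.
          have := congr1 (fun v => nth t0 v q) E; rewrite Eu !nth_cat qs => <-.
          by rewrite (ltn_trans qs s1c).
        rewrite fZ_prefix; [by rewrite xs sc|exact: pi_ne|].
        by rewrite xs sc; exact: ltn_trans s1c.
      have lt : (q - size s1 < size w)%N by rewrite ltn_subLR.
      rewrite nth_cat lt -[X in nth _ X _]xw nth_factor//.
      have eq : q = (size s1 + (q - size s1))%N by rewrite subnKC.
      by rewrite sk {1}eq PoszD addrA.
    move: h3; rewrite h1 h2 (nth_pi_letter (Ordinal sz)) (nth_pi_letter (Ordinal sz')).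
    by move/(congr1 tag).
  by rewrite /cyl/gcyl /mkset pref// take_size.
rewrite /cyl/gcyl /mkset => xv.
have x1 : x 1 = c by move: xv; rewrite /= factorS; case.
split; first by rewrite /letter_set /= x1.
have := piZ_word x (size v); rewrite xv E.
rewrite !size_cat factor_cat factor_cat => /eqP.
rewrite eqseq_cat ?size_factor// => /andP[_].
rewrite eqseq_cat ?size_factor// => /andP[/eqP xw _].
by rewrite /mkset sk.
Qed.

Section FiniteMeasure.
Variables (R : realType) (mu : {measure set (shspace a0) -> \bar R}).

Lemma hat_meas_tower s t : hat_meas mu (s :: t) = mu (tower_set s (s :: t)).
Proof.
rewrite /hat_meas; case E : (hat (s :: t)) => [u|].
  by rewrite (tower_set_hat E).
suff -> : tower_set s (s :: t) = set0 by rewrite measure0.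
by apply/seteqP; split=> // x /tower_set_infix; exact: hat_none E _.
Qed.

Hypothesis fmu : (mu setT < +oo)%E.

Lemma measurable_tower_set s t : measurable (tower_set s t : set (shspace a0)).
Proof.
apply: local_measurable; apply: localI; first exact: local_letter_set.
exact: (fZ_local t0 pi (local_factor _ _ [set w | w = t])).
Qed.

(** Floors of the suspension are the letters s of A_f. When floor s is cut by the word t that
    pi^Z(x) shows there, only words beginning with s remain, so the sum over s and t collapses to a
    sum over t, evaluated by [hat_meas_tower]. *)
Lemma op_cyl (w : seq B) : w != [::] ->
  (op b0 f (fm mu) (cyl b0 w))%:E =
  (\sum_(t : (size w).-tuple (tletter f) | map (@alpha A B b0 f) t == w) hat_meas mu t)%E.
Proof.
case: w => // b w _; set w' := b :: w; set n := size w'.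
have hd (t : n.-tuple TL) : tval t = thead t :: behead t by rewrite [t in LHS]tuple_eta.
have -> : (\sum_(t : n.-tuple (tletter f) | map (@alpha A B b0 f) t == w') hat_meas mu t)%E
   = (\sum_(t : n.-tuple TL | map (@alpha A B b0 f) t == w')
       fm mu (tower_set (thead t) t))%:E.
  rewrite -sumEFin; apply: eq_bigr => t _.
  by rewrite -(fmE fmu (measurable_tower_set _ _)) hd hat_meas_tower.
congr EFin; rewrite /op.
rewrite (@sig_big_dep _ _ _ A (fun a => 'I_(size (f a))) xpredT (fun _ => xpredT)
  (fun a k => fm mu (letter_set a `&` [set x | cyl b0 w' (sh (k : nat)%:Z (fZ b0 f x))]))) /=.
have mc : measurable (cyl b0 w' : set (shspace b0)) by apply: sub_sigma_algebra; exists 1, w'.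
pose Es (s : TL) : set (shspace a0) :=
  letter_set (tag s) `&` [set x | cyl b0 w' (sh (tagged s : nat)%:Z (fZ b0 f x))].
pose G (s : TL) (t : n.-tuple TL) : set (shspace a0) :=
  [set x | factor (piZ x) (1 + (tagged s : nat)%:Z) n = t].
have mG s (t : n.-tuple TL) : measurable (G s t).
  apply: local_measurable.
  exact: (fZ_local t0 pi (local_factor _ _ [set w | w = tval t])).
have mEs s : measurable (Es s) by exact: measurable_op_setI.
have step s : fm mu (Es s) = \sum_(t : n.-tuple TL) fm mu (Es s `&` G s t).
  apply: (fm_sum fmu (mEs s) (mG s)).
    by move=> t t' x _ /= e e'; apply: val_inj; exact: etrans (esym e) e'.
  move=> x _.
  have sz : size (factor (piZ x) (1 + (tagged s : nat)%:Z) n) == n by rewrite size_factor.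
  by exists (Tuple sz).
rewrite (eq_bigr (fun s => fm mu (Es s)))//.
under eq_bigr do rewrite step.
rewrite exchange_big /= [RHS]big_mkcond; apply: eq_bigr => t _.
have hEs s x : (Es s `&` G s t) x -> s = thead t /\ map (@alpha A B b0 f) t == w'.
  move=> [[xs cx] Gx]; split.
    have e : piZ x (1 + (tagged s : nat)%:Z) = thead t.
      by move: Gx; rewrite /G /mkset hd /n /= factorS => -[].
    by rewrite -e piZ_head.
  move: cx; rewrite /cyl/gcyl/= factor_sh => <-.
  by rewrite -/n -map_alpha_piZ Gx.
case: ifP => h.
  rewrite (bigD1 (thead t)) //= [X in _ + X]big1 ?addr0 => [|s /eqP sn]; last first.
    rewrite -[RHS](fm0 mu); congr fm; apply/seteqP; split=> // x /hEs[].
    by move=> e; case: sn.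
  congr fm; apply/seteqP; split=> [x [[xs _] Gx]|x [xs Gx]].
    by split=> //=; rewrite size_tuple.
  have Gx' : factor (piZ x) (1 + (tagged (thead t) : nat)%:Z) n = t.
    by move: Gx; rewrite /mkset size_tuple.
  split=> //; split=> //; rewrite /mkset /cyl/gcyl/mkset factor_sh -/n.
  by rewrite -map_alpha_piZ Gx'; exact/eqP.
rewrite big1// => s _; rewrite -[RHS](fm0 mu); congr fm; apply/seteqP.
by split=> // x /hEs[_]; rewrite h.
Qed.

End FiniteMeasure.
End Transfer.

Section TransferMeasures.
Variables (R : realType) (A B : finType) (a0 : A) (b0 : B) (f : A -> seq B).
Hypothesis ne : non_erasing f.
Variables (mu : {measure set (shspace a0) -> \bar R}).
Hypothesis imu : inv_fin_measure mu.

Lemma op_transfer (nu : {measure set (shspace b0) -> \bar R}) :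
  (forall E : set (shspace b0), measurable E -> nu E = (op b0 f (fm mu) E)%:E) ->
  transfer a0 b0 f mu nu.
Proof.
move=> h w w0; rewrite h; first by rewrite (op_cyl b0 ne imu.1 w0).
by apply: sub_sigma_algebra; exists 1, w.
Qed.

Lemma op_measure_inv : exists nu : {measure set (shspace b0) -> \bar R},
  inv_fin_measure nu /\
  forall E : set (shspace b0), measurable E -> nu E = (op b0 f (fm mu) E)%:E.
Proof.
have [nu [fnu nuE]] := op_measure b0 f imu.1; exists nu; split=> //; split=> // E mE.
have mE' : measurable (sh 1 @^-1` E : set (shspace b0)) by exact: measurable_sh.
rewrite [LHS]nuE; last exact: mE'.
by rewrite nuE// (op_inv ne imu.1 mE imu.2).
Qed.

(** The cylinder formula determines nu through invariance: the invariant measure given by [op] has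
    the same cylinder values. *)
Lemma transfer_op (nu : {measure set (shspace b0) -> \bar R}) :
  inv_fin_measure nu -> transfer a0 b0 f mu nu ->
  forall E : set (shspace b0), measurable E -> nu E = (op b0 f (fm mu) E)%:E.
Proof.
move=> inu tr; have [nu' [inu' nuE]] := op_measure_inv.
have h : meq nu nu'.
  by apply: meq_cyl => // w w0; rewrite (tr w w0) (op_transfer nuE w0).
by move=> E mE; rewrite (h E mE) nuE.
Qed.

End TransferMeasures.

(** * Inverting the transfer along a recognizable morphism *)

Section Recognizable.
Variables (R : realType) (A B : finType) (a0 : A) (b0 : B) (f : A -> seq B).
Hypothesis ne : non_erasing f.
Variable Y : set (int -> A).
Hypothesis Ycl : sclosed Y.
Hypothesis Ysh : forall k x, Y x -> Y (sh k x).
Hypothesis rec : recognizable f Y.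
Local Notation F := (fZ b0 f).
Local Notation SA := (shspace a0).
Local Notation SB := (shspace b0).

Definition img (E : set (int -> A)) : set (int -> B) := F @` (E `&` Y).

Lemma fZ_recog x x' k l : Y x -> Y x' ->
  (k < size (f (x 1%R)))%N -> (l < size (f (x' 1%R)))%N ->
  sh k%:Z (F x) = sh l%:Z (F x') -> x = x' /\ k = l.
Proof.
move=> Yx Yx' kx lx' e.
apply: (rec Yx Yx' (fZ_sigmaZ b0 ne x) (fZ_sigmaZ b0 ne x') kx lx') => i.
by have := congr1 (fun y => y i) e.
Qed.

Lemma fZ_inj x x' : Y x -> Y x' -> F x = F x' -> x = x'.
Proof.
move=> Yx Yx' e; have [] // := @fZ_recog x x' 0%N 0%N Yx Yx' (ne _) (ne _).
by rewrite e.
Qed.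

Lemma imgE E x : Y x -> img E (F x) <-> E x.
Proof.
move=> Yx; split=> [[x' [Ex' Yx'] e]|Ex]; last by exists x.
by rewrite -(fZ_inj Yx' Yx e).
Qed.

Lemma imgI E E' : img (E `&` E') = img E `&` img E'.
Proof.
apply/seteqP; split=> [_ [x [[Ex E'x] Yx] <-]|_ [[x [Ex Yx] <-] /(imgE _ Yx) E'x]].
  by split; exists x.
by exists x.
Qed.

Lemma img0 : img set0 = set0.
Proof. by apply/seteqP; split=> // y [x []]. Qed.

Lemma img_bigcup (G : nat -> set (int -> A)) : img (\bigcup_k G k) = \bigcup_k img (G k).
Proof.
apply/seteqP; split=> [_ [x [[n _ Gx] Yx] <-]|_ [n _ [x [Gx Yx] <-]]].
  by exists n => //; exists x.
by exists x => //; split=> //; exists n.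
Qed.

(** Preimages of the approximating points have a limit point, again in E and Y, and continuity of
    f^Z sends it to the limit. *)
Lemma img_sclosed E : local E -> sclosed (img E).
Proof.
move=> [m hE] y z hy yz.
have /choice[x hx] n : exists x, (E `&` Y) x /\ F x = y n.
  by have [x] := hy n; exists x.
have [t ht] := seq_compact x; have /choice[N hN] n : exists N, (n <= N)%N /\ agree n (x N) t.
  by have [N] := ht n; exists N.
have Yt : Y t.
  by apply: (Ycl (x := x \o N)) => n /=; [have [[]] := hx (N n)|have [] := hN n].
have Et : E t by apply: hE (hN m).2 _; have [[]] := hx (N m).
exists t => //; apply/funext => p; set n := absz p.
have [nN a] := hN n.+1.
rewrite -(fZ_agree b0 f a)//; have [_ ->] := hx (N n.+1).
by apply: yz; exact: ltnW.
Qed.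

(** Injectivity of f^Z on Y makes images commute with relative complements, so the sets with
    measurable image form a sigma-algebra containing the clopen sets. *)
Lemma measurable_img (E : set SA) : measurable E -> measurable (img E : set SB).
Proof.
have mT : measurable (img setT : set SB).
  by apply: sclosed_measurable; apply: img_sclosed; exact: localT.
rewrite measurable_sigma_local => mE.
have := @smallest_sub _ (sigma_algebra setT) (@local A)
  [set E | measurable (img E : set SB)].
apply=> //; first split=> [|G mG|G mG] /=.
- by rewrite img0.
- have -> : img (setT `\` G) = img setT `\` img G.
    apply/seteqP; split=> [_ [x [[_ Gx] Yx] <-]|_ [[x [_ Yx] <-] nG]].
      by split; [exists x|move=> /(imgE _ Yx)].
    by exists x => //; split=> //; split=> // Gx; apply: nG; exists x.
  exact: measurableD.
- by rewrite img_bigcup; exact: bigcupT_measurable.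
- by move=> G lG /=; apply: sclosed_measurable; exact: img_sclosed.
Qed.

(** For x in Y and k below the roof, recognizability allows T^k f^Z(x) to lie in the image of E only
    if k = 0 and x is in E; the bottom floors carry the whole sum. *)
Lemma op_img (mu : {measure set SA -> \bar R}) (E : set SA) :
  (mu setT < +oo)%E -> supported_in Y mu -> measurable E ->
  op b0 f (fm mu) (img E) = fm mu E.
Proof.
move=> fmu sY mE.
have mN : measurable (~` Y : set SA) by apply: measurableC; exact: sclosed_measurable.
have mI := measurable_img mE.
rewrite (fm_letters fmu mE); apply: eq_bigr => a _.
rewrite (bigD1 (Ordinal (ne a)))//= big1 ?addr0 => [|k k0].
  apply: (eq_fm_null fmu mN sY).
  - exact: measurable_op_setI.
  - by apply: measurableI => //; exact: measurable_letter_set.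
  - move=> x /contrapT Yx; split=> -[xa] /=.
      by rewrite sh0 => /(imgE _ Yx).
    by move=> Ex; split=> //=; rewrite sh0; apply/(imgE _ Yx).
rewrite -[RHS](fm0 mu); apply: (eq_fm_null fmu mN sY) => //.
  exact: measurable_op_setI.
move=> x /contrapT Yx; split=> // -[xa] /= [x' [Ex' Yx'] e].
have [] // := @fZ_recog x' x 0%N k Yx' Yx (ne _); first by rewrite xa.
  by rewrite sh0 e.
move=> _ k0'; move/eqP: k0; case; apply: val_inj => /=.
exact/esym.
Qed.

Lemma op_inj (mu1 mu2 : {measure set SA -> \bar R}) :
  inM Y mu1 -> inM Y mu2 ->
  (forall E : set SB, measurable E -> op b0 f (fm mu1) E = op b0 f (fm mu2) E) ->
  meq mu1 mu2.
Proof.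
move=> [[f1 _] s1] [[f2 _] s2] h E mE; rewrite (fmE f1 mE) (fmE f2 mE).
by rewrite -(op_img f1 s1 mE) -(op_img f2 s2 mE) h//; exact: measurable_img.
Qed.

Lemma op_surj (Z : set SB) (nu : {measure set SB -> \bar R}) :
  measurable Z ->
  (forall y, Z y -> exists x k, [/\ Y x, (k < size (f (x 1%R)))%N & y = sh k%:Z (F x)]) ->
  inM Z nu ->
  exists mu : {measure set SA -> \bar R}, inM Y mu /\
    forall E : set SB, measurable E -> nu E = (op b0 f (fm mu) E)%:E.
Proof.
move=> mZ cZ [[fnu inu] sZ].
pose m (E : set SA) : \bar R := nu (img E).
have m0 : m set0 = 0%E by rewrite /m img0 measure0.
have mge0 E : (0 <= m E)%E by exact: measure_ge0.
have madd : semi_sigma_additive m.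
  move=> G mG tG mUG; rewrite /m.
  rewrite img_bigcup; apply: measure_semi_sigma_additive.
  - by move=> i; exact: measurable_img.
  - move=> i j _ _ [y []]; rewrite -/((img (G i) `&` img (G j)) y) => yi yj.
    have : (img (G i `&` G j)) y by rewrite imgI.
    by move=> [x [Gx _] _]; apply: tG => //; exists x.
  - by rewrite -img_bigcup; exact: measurable_img.
pose mu : {measure set SA -> \bar R} :=
  HB.pack m (isMeasure.Build _ _ _ m m0 mge0 madd).
have muE (E : set SA) : mu E = nu (img E) by [].
have fmu : (mu setT < +oo)%E.
  rewrite muE; apply: le_lt_trans fnu; apply: le_measure; rewrite ?inE//.
  exact: measurable_img.
(* For invariance, E is cut by the letter a that the shift moves from coordinate 1 to coordinate 0.
   On each piece the image moves by the constant |f(a)|, and nu is invariant. *)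
pose last a : set SA := [set x | x 0 = a].
have mlast a : measurable (last a).
  by apply: local_measurable; exact: (local_coord [set b | b = a] 0).
have imu : shift_invariant mu.
  move=> E mE; have mE' : measurable (sh 1 @^-1` E : set SA) by exact: measurable_sh.
  rewrite (measure_sum mu (G := last) mE) //; last 2 first.
  - by move=> a b x _ <- <-.
  - by move=> x _; exists (x 0).
  rewrite -[@Defs.shift A a0 @^-1` E]/(sh 1 @^-1` E).
  rewrite (measure_sum mu (G := @letter_set A) mE') //; last 3 first.
  - by move=> a; exact: measurable_letter_set.
  - by move=> a b x _ <- <-.
  - by move=> x _; exists (x 1).
  apply: eq_bigr => a _; rewrite !muE.
  have mEl : measurable (E `&` last a) by exact: measurableI.
  rewrite -(inv_sh inu (size (f a))%:Z (measurable_img mEl)); congr (nu _).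
  apply/seteqP; split=> [_ [x [[Ex xa] Yx] <-]|y [x [[Ex xa] Yx] e]].
    exists (sh 1 x); last by rewrite fZ_sh1// xa.
    by split; [split=> //; rewrite /last /= /sh add0r|exact: Ysh].
  exists (sh (- 1) x); last first.
    have x1 : sh (- 1) x 1 = a by rewrite /sh subrr.
    have e' := fZ_sh1 b0 ne (sh (- 1) x); rewrite shNK e x1 in e'.
    by rewrite -(shK (size (f a))%:Z y) e' shK.
  split; last exact: Ysh.
  by split; rewrite /= ?shNK// /letter_set /= /sh subrr.
exists mu; split.
  split=> //; rewrite /supported_in muE.
  suff -> : img (~` Y) = set0 by rewrite measure0.
  by apply/seteqP; split=> // y [x []].
move=> E mE; pose TL := ({a : A & 'I_(size (f a))} : finType).
(* With s = (a, k), [G s] holds the points on floor k over the letter a. Recognizability makes these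
   sets disjoint, and the covering hypothesis makes them exhaust Z. *)
pose G (s : TL) : set SB := sh (- (tagged s : nat)%:Z) @^-1` img (letter_set (tag s)).
have mG s : measurable (G s).
  by apply: measurable_sh; apply: measurable_img; exact: measurable_letter_set.
have mNZ : measurable (~` Z) by exact: measurableC.
rewrite (fmE fnu mE); congr EFin.
rewrite (@eq_fm_null _ _ _ _ fnu _ E (E `&` Z) mNZ sZ mE); last 2 first.
- exact: measurableI.
- by move=> y /contrapT Zy; split=> [|[]].
rewrite (fm_sum fnu (measurableI _ _ mE mZ) mG); last 2 first.
- move=> [a k] [b l] y _ [x [xa Yx] e1] [x' [xb Yx'] e2].
  have [|||exx' kl] := @fZ_recog x x' k l Yx Yx'.
  + by rewrite [x 1]xa.
  + by rewrite [x' 1]xb.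
  + by rewrite e1 e2 /= !shNK.
  have ab : a = b by rewrite -[a]xa -[b]xb exx'.
  by subst b; congr (Tagged _ _); apply: val_inj.
- move=> y [_ /cZ[x [k [Yx kx ->]]]].
  exists (Tagged (fun a => 'I_(size (f a))) (Ordinal kx)).
  by exists x => //; rewrite /= shK.
rewrite /op (@sig_big_dep _ _ _ A (fun a => 'I_(size (f a))) xpredT (fun _ => xpredT)
  (fun a k => fm mu (letter_set a `&` [set x | E (sh (k : nat)%:Z (F x))]))) /=.
apply: eq_bigr => s _.
transitivity (fm nu (E `&` G s)).
  apply: (eq_fm_null fnu mNZ sZ).
  - by apply: measurableI => //; exact: measurableI.
  - exact: measurableI.
  - by move=> y /contrapT Zy; split=> [[[Ey _] Gy]|[Ey Gy]].
rewrite /fm -(inv_sh inu (tagged s : nat)%:Z (measurableI _ _ mE (mG s))).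
rewrite muE; congr (fine (nu _)).
apply/seteqP; split=> [y [Ey [x [xs Yx] e]]|_ [x [[xs Ex] Yx] <-]].
  rewrite /= shK in e; rewrite -e in Ey *.
  by exists x.
by split=> //; exists x => //; rewrite /= shK.
Qed.

End Recognizable.

(** * Directive sequences *)

Section Desubstitution.
Variables (A B : finType) (a0 : A) (b0 : B) (f : A -> seq B).
Hypothesis ne : non_erasing f.

Lemma subst_split (w : seq A) q : (q < size (subst f w))%N ->
  exists w1 c w2 l, [/\ w = w1 ++ c :: w2, (l < size (f c))%N &
                        q = (size (subst f w1) + l)%N].
Proof.
elim: w q => // c w IH q; rewrite subst_cons size_cat => qw.
have [qc|cq] := ltnP q (size (f c)); first by exists [::], c, w, q.
have [|w1 [d [w2 [l [-> ld e]]]]] := IH (q - size (f c))%N; first by lia.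
exists (c :: w1), d, w2, l; split=> //; rewrite subst_cons size_cat; lia.
Qed.

Lemma size_subst_le L (w : seq A) : (forall a, (size (f a) <= L)%N) ->
  (size (subst f w) <= L * size w)%N.
Proof.
move=> hL; elim: w => // a w IH; rewrite subst_cons size_cat mulnS.
exact: leq_add.
Qed.

(* The margin [L * M.+2] leaves at least [M.+1] letters of [w] on both sides of
   the letter whose image covers position 1. *)
Lemma desubst L (y : int -> B) n (w : seq A) :
  (forall a, (size (f a) <= L)%N) -> (0 < n)%N ->
  infix (factor y (- n%:Z) n.*2.+1) (subst f w) ->
  exists x l, [/\ (l < size (f (x 1%R)))%N, agree n (sh l%:Z (fZ b0 f x)) y &
    forall M, (L * M.+2 <= n)%N -> infix (factor x (- M%:Z) M.*2.+1) w].
Proof.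
move=> hL n0 /infixP[s1 [s2 E]].
have sE : size (subst f w) = (size s1 + (n.*2.+1 + size s2))%N.
  by rewrite E !size_cat size_factor.
(* Position 1 of y has index n + 1 in the window on [-n, n], which is inside since n > 0; l is its
   offset in the block of c. *)
have [|w1 [c [w2 [l [wE lc qE]]]]] := @subst_split w (size s1 + n.+1).
  by rewrite sE; lia.
pose x (i : int) : A := if i - 1 + (size w1)%:Z < 0 then a0
  else nth a0 w (absz (i - 1 + (size w1)%:Z)%R).
have xw : factor x (1 - (size w1)%:Z) (size w) = w.
  apply/(factorP _ _ _ a0) => j jw; rewrite /x.
  have -> : 1 - (size w1)%:Z + j%:Z - 1 + (size w1)%:Z = j%:Z by lia.
  by [].
have x1 : x 1 = c.
  by rewrite /x subrr add0r /= wE nth_cat ltnn subnn.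
have xw1 : factor x (1 - (size w1)%:Z) (size w1) = w1.
  have := xw; rewrite {1 2}wE size_cat factor_cat => /eqP.
  by rewrite eqseq_cat ?size_factor// => /andP[/eqP].
have st : start f x (1 - (size w1)%:Z) = 1 - (size (subst f w1))%:Z.
  by have := start_factor f x (1 - (size w1)%:Z) (size w1); rewrite xw1 subrK start1; lia.
exists x, l; split; first by rewrite x1.
  apply/agree_factorP; rewrite factor_sh.
  have := fZ_subst b0 ne x (1 - (size w1)%:Z) (size w).
  rewrite xw st sE factor_cat factor_cat E => /eqP.
  rewrite eqseq_cat ?size_factor// => /andP[_].
  rewrite eqseq_cat ?size_factor// => /andP[/eqP h _].
  by rewrite -h; congr Defs.factor; lia.
move=> M hM; rewrite -[X in infix _ X]xw.
have L0 : (0 < L)%N by exact: leq_trans (ne c) (hL c).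
have h1 := size_subst_le w1 hL.
have h2 := size_subst_le (c :: w2) hL.
have lL : (l < L)%N by exact: leq_trans lc (hL c).
have ew : size (subst f w) = (size (subst f w1) + size (subst f (c :: w2)))%N.
  by rewrite wE subst_cat size_cat.
have M1 : (M.+1 < size w1)%N.
  rewrite -(ltn_pmul2l L0); move: hM; rewrite !mulnS; lia.
have M2 : (M.+1 < size (c :: w2))%N.
  rewrite -(ltn_pmul2l L0); move: hM; rewrite [(L * M.+2)%N]mulnS; lia.
apply: infix_factor; first by lia.
by rewrite wE size_cat; lia.
Qed.

End Desubstitution.

(** * Languages and subshifts of the levels *)

Section Sequence.
Variables (A : nat -> finType) (a0 : forall n, A n)
  (sigma : forall n, A n.+1 -> seq (A n)).
Arguments sigma : clear implicits.
Hypothesis Hne : non_erasing_seq sigma.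
Arguments Hne : clear implicits.

(* Quantifying over [P] avoids casts between [A (j + k.+1)] and [A (j.+1 + k)]. *)
Lemma sigma_toS k j (P : forall m, (A m -> seq (A k)) -> Prop) :
  P (j.+1 + k)%N (sigma_to sigma k j.+1) <->
  P (j + k.+1)%N (fun a => subst (sigma k) (sigma_to sigma k.+1 j a)).
Proof.
elim: j P => [|j IH] P.
  suff -> : sigma_to sigma k 1 = (fun a => subst (sigma k) (sigma_to sigma k.+1 0 a)) by [].
  by apply/funext => a; rewrite /= subst1 /subst /= cats0.
have := IH (fun m g => P m.+1 (fun a => subst g (sigma m a))) => /= ->.
suff -> : (fun a => subst (fun a' => subst (sigma k) (sigma_to sigma k.+1 j a'))
            (sigma (j + k.+1)%N a)) =
    (fun a => subst (sigma k) (subst (sigma_to sigma k.+1 j) (sigma (j + k.+1)%N a))) by [].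
by apply/funext => a; rewrite subst_comp.
Qed.

Lemma sigma_to_ne k j : non_erasing (sigma_to sigma k j).
Proof.
by elim: j => [|j IH] //=; apply: non_erasing_comp => //; exact: Hne.
Qed.

Lemma sig0_ne n : non_erasing (sig0 sigma n).
Proof.
by elim: n => [|n IH] //=; apply: non_erasing_comp => //; exact: Hne.
Qed.

Lemma infix_subst (B C : eqType) (f : B -> seq C) u w :
  infix u w -> infix (subst f u) (subst f w).
Proof.
move=> /infixP[s1 [s2 ->]]; rewrite !subst_cat; exact: infix_infix.
Qed.

Lemma lang_infix k u w : infix u w -> lang sigma k w -> lang sigma k u.
Proof. by move=> uw [j [a wa]]; exists j, a; exact: infix_trans uw wa. Qed.

Lemma lang_subst k u w : lang sigma k.+1 w -> infix u (subst (sigma k) w) ->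
  lang sigma k u.
Proof.
move=> [j [a wa]] uw.
suff : exists a, infix u (sigma_to sigma k j.+1 a) by exists j.+1.
apply: (@sigma_toS k j (fun m g => exists a, infix u (g a))).2.
by exists a; apply: infix_trans uw _; exact: infix_subst.
Qed.

(** Length at least 2 excludes j = 0, where only single letters arise, so there is a lowest morphism
    to peel off. *)
Lemma lang_desubst k u : lang sigma k u -> (1 < size u)%N ->
  exists2 w, lang sigma k.+1 w & infix u (subst (sigma k) w).
Proof.
move=> [[|j] [a ua]] u1; first by have := size_infix ua; rewrite /= leqNgt u1.
have [b ub] := (@sigma_toS k j (fun m g => exists a, infix u (g a))).1 (ex_intro _ a ua).
by exists (sigma_to sigma k.+1 j b) => //; exists j, b; exact: infix_refl.
Qed.

Lemma X_sclosed k : sclosed (X sigma k).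
Proof.
move=> x y Xx xy i n; suff -> : factor y i n = factor (x (absz i + n)%N) i n by exact: Xx.
by apply/factor_eqP => j jn; rewrite xy//; lia.
Qed.

Lemma X_sh k l x : X sigma k x -> X sigma k (sh l x).
Proof. by move=> Xx i n; rewrite factor_sh; exact: Xx. Qed.

Lemma X_windows k x :
  (forall M, exists2 n, (M <= n)%N & lang sigma k (factor x (- n%:Z) n.*2.+1)) ->
  X sigma k x.
Proof.
move=> h i n; have [m Mm] := h (absz i + n)%N; apply: lang_infix.
by apply: infix_factor; lia.
Qed.

Lemma X_fZ k x l : X sigma k.+1 x -> X sigma k (sh l (fZ (a0 k) (sigma k) x)).
Proof.
move=> Xx i n; rewrite factor_sh.
pose M := (absz (i + l)%R + n).+1.
apply: (lang_subst (Xx (1 - M%:Z) M.*2)).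
rewrite -(fZ_subst (a0 k) (Hne k)); apply: infix_factor.
  have := start_ge (Hne k) x (1 - M%:Z) M; rewrite subrK start1 /M; lia.
rewrite -start_factor.
have -> : 1 - M%:Z + M.*2%:Z = 1 + M%:Z by lia.
have hM : i + l + n%:Z <= 1 + M%:Z by rewrite /M; lia.
by apply: le_trans hM _; rewrite -{1}(start1 (sigma k) x); exact: start_ge.
Qed.

(** Each window of y is desubstituted on its own, up to an offset; a limit of these local solutions
    desubstitutes y. *)
Lemma X_cover k y : X sigma k y -> exists x l,
  [/\ X sigma k.+1 x, (l < size (sigma k (x 1%R)))%N &
      y = sh l%:Z (fZ (a0 k) (sigma k) x)].
Proof.
move=> Xy; pose L := (\max_(a : A k.+1) size (sigma k a))%N.
have hL a : (size (sigma k a) <= L)%N by exact: leq_bigmax.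
have /choice[x /choice[l hx]] N : exists x l, [/\ (l < size (sigma k (x 1%R)))%N,
    agree N.+1 (sh l%:Z (fZ (a0 k) (sigma k) x)) y &
    forall M, (L * M.+2 <= N.+1)%N -> lang sigma k.+1 (factor x (- M%:Z) M.*2.+1)].
  have [|w lw uw] := lang_desubst (Xy (- N.+1%:Z) N.+1.*2.+1).
    by rewrite size_factor; lia.
  have [x [l [lx a h]]] := desubst (a0 k.+1) (a0 k) (Hne k) hL (ltn0Sn N) uw.
  by exists x, l; split=> // M /h; move/lang_infix; apply.
(* Pairing every coordinate with the offset gives sequences over one finite alphabet, so a single
   limit settles both. *)
pose z N (i : int) : A k.+1 * 'I_L.+1 := (x N i, inord (l N)).
have [t ht] := seq_compact z.
pose x' i := (t i).1; pose l' := nat_of_ord (t 1).2.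
have lL N : (l N < L.+1)%N.
  by have [lx _ _] := hx N; rewrite ltnS; apply: leq_trans (ltnW lx) (hL _).
have agx n N : agree n (z N) t -> agree n (x N) x'.
  by move=> a i iN; rewrite /x' -a.
have agl n N : (0 < n)%N -> agree n (z N) t -> l N = l'.
  by move=> n0 a; rewrite /l' -a//= inordK.
exists x', l'; split.
- apply: X_windows => M; exists M => //.
  have [N nN a] := ht (M + L * M.+2)%N.
  have [_ _ /(_ M) h] := hx N; have {}h : lang sigma k.+1 (factor (x N) (- M%:Z) M.*2.+1).
    by apply: h; lia.
  suff <- : factor (x N) (- M%:Z) M.*2.+1 = factor x' (- M%:Z) M.*2.+1 by [].
  by apply/agree_factorP; apply: agreeS (agx _ _ a); exact: leq_addr.
- have [N _ a] := ht 1%N; rewrite -(agl _ _ _ a)// -(agx _ _ a)//.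
  by have [] := hx N.
- apply/funext => p; have [N nN a] := ht (absz p + L).+2.
  have e := agl _ _ (ltn0Sn _) a; have [_ ag _] := hx N.
  rewrite -ag; last by lia.
  rewrite /sh e; apply: (fZ_agree (a0 k) (sigma k) (agx _ _ a)).
  by have := lL N; rewrite e; lia.
Qed.

End Sequence.

(** * Towers of measures and of vectors *)

Lemma ultra_cvg (R : realType) (U : set_system nat) (r : nat -> R) (C : R) :
  UltraFilter U -> (forall n, 0 <= r n <= C) -> exists l : R, r @ U --> l.
Proof.
move=> UU hr.
have PF : ProperFilter U by exact: ultra_proper.
have [l [_ cl]] : `[0, C]%classic `&` cluster (r @ U) !=set0.
  apply: (@segment_compact R 0 C (r @ U)).
  suff : U [set n | `[0, C]%classic (r n)] by [].
  by apply: filterE => n; rewrite /= in_itv /=; exact: hr.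
exists l; apply/cvgrPdist_lt => e e0.
have [//|nU] := in_ultra_setVsetC [set n | `|l - r n| < e] UU.
have h1 : (r @ U) [set z | ~ `|l - z| < e] by [].
have h2 : nbhs l [set z | `|l - z| < e] by apply/nbhs_ballP; exists e.
by have [z []] := cl _ _ h1 h2.
Qed.

Lemma cvg_sumr (R : realType) (I : Type) (U : set_system nat) (s : seq I)
    (r : I -> nat -> R) (l : I -> R) :
  Filter U -> (forall i, r i @ U --> l i) ->
  (fun n => \sum_(i <- s) r i n) @ U --> \sum_(i <- s) l i.
Proof.
move=> FU h; elim: s => [|i s IH].
  rewrite big_nil (_ : (fun _ => _) = cst 0); first exact: cvg_cst.
  by apply/funext => n; rewrite big_nil.
rewrite big_cons (_ : (fun _ => _) = (r i \+ (fun n => \sum_(i <- s) r i n))).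
  exact: cvgD.
by apply/funext => n; rewrite big_cons.
Qed.

Lemma cvg_sumr_ord (R : realType) (N : nat) (U : set_system nat)
    (r : 'I_N -> nat -> R) (l : 'I_N -> R) :
  Filter U -> (forall i, r i @ U --> l i) ->
  (fun n => \sum_(i < N) r i n) @ U --> \sum_(i < N) l i.
Proof. by move=> FU h; exact: cvg_sumr. Qed.

Section Identity.
Variables (R : realType) (A : finType) (a0 : A).

Lemma start_id (x : int -> A) i : start (fun a => [:: a]) x i = i.
Proof.
move: i; apply: int_ind1 => [|i]; first by rewrite start1.
by rewrite startS /=; split=> [->|/addIr].
Qed.

Lemma fZ_id (x : int -> A) : fZ a0 (fun a => [:: a]) x = x.
Proof.
by apply/esym; apply: sigmaZ_uniq => // i; rewrite start_id /= factor1.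
Qed.

Lemma op_id (mu : {measure set (shspace a0) -> \bar R}) (E : set (shspace a0)) :
  (mu setT < +oo)%E -> measurable E ->
  op a0 (fun a => [:: a]) (fm mu) E = fm mu E.
Proof.
move=> fmu mE; rewrite (fm_letters fmu mE); apply: eq_bigr => a _.
rewrite big_ord_recl big_ord0 addr0; congr fm; congr (_ `&` _).
by apply/seteqP; split=> x /=; rewrite sh0 fZ_id.
Qed.

End Identity.

Lemma size_sum_count (B : finType) (s : seq B) : size s = (\sum_(b : B) count_mem b s)%N.
Proof.
elim: s => [|c s IH]; first by rewrite big1.
rewrite /= IH big_split /= -add1n; congr (_ + _)%N.
rewrite (bigD1 c)//= eqxx big1 ?addn0// => b.
by rewrite eq_sym => /negPf ->.
Qed.

Section Towers.
Variables (R : realType) (A : nat -> finType) (a0 : forall n, A n)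
  (sigma : forall n, A n.+1 -> seq (A n)).
Arguments sigma : clear implicits.
Hypothesis Hne : non_erasing_seq sigma.
Arguments Hne : clear implicits.
Local Notation S n := (shspace (a0 n)).

Definition optower (mu : forall n, {measure set (S n) -> \bar R}) : Prop :=
  (forall n, (mu n setT < +oo)%E) /\
  forall n (E : set (S n)), measurable E ->
    fm (mu n) E = op (a0 n) (sigma n) (fm (mu n.+1)) E.

Section OpTower.
Variable mu : forall n, {measure set (S n) -> \bar R}.
Arguments mu : clear implicits.
Hypothesis tmu : optower mu.

Lemma optower_sigma_to k j (E : set (S k)) : measurable E ->
  fm (mu k) E = op (a0 k) (sigma_to sigma k j) (fm (mu (j + k)%N)) E.
Proof.
move=> mE; elim: j => [|j IH]; first by rewrite op_id//; exact: tmu.1.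
rewrite IH -(@op_comp _ _ _ _ (a0 (j + k)%N) (a0 k) _ _ _ E
  (@sigma_to_ne _ _ Hne k j) (Hne _) (fm0 _)).
by apply: (op_ext (a0 := a0 _) _ mE) => F mF; exact: tmu.2.
Qed.

Lemma optower_sig0 n (E : set (S 0%N)) : measurable E ->
  fm (mu 0%N) E = op (a0 0%N) (sig0 sigma n) (fm (mu n)) E.
Proof.
move=> mE; elim: n => [|n IH]; first by rewrite op_id//; exact: tmu.1.
rewrite IH -(@op_comp _ _ _ _ (a0 n) (a0 0%N) _ _ _ E (@sig0_ne _ _ Hne n) (Hne n) (fm0 _)).
by apply: (op_ext (a0 := a0 _) _ mE) => F mF; exact: tmu.2.
Qed.

Hypothesis Hgrow : everywhere_growing sigma.

(** Once all words sigma_[0,n)(a) have length at least T, the suspension makes T times the mass of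
    mu_n at most the mass C of mu_0; T is taken above C / e. *)
Lemma optower_mass (e : R) : 0 < e ->
  exists N, forall n, (N <= n)%N -> fm (mu n) setT <= e.
Proof.
move=> e0; pose C := fm (mu 0%N) setT.
have [N hN] := Hgrow (Num.truncn (C / e)).+1.
exists N => n /hN hn.
have : (Num.truncn (C / e)).+1%:R * fm (mu n) setT <= C.
  rewrite [X in _ <= X](optower_sig0 n measurableT) opT (fm_lettersT (tmu.1 n)) mulr_sumr.
  apply: ler_sum => a _; rewrite mulrC; apply: ler_wpM2l; first exact: fm_ge0.
  by rewrite ler_nat; exact: hn.
have h : C / e < (Num.truncn (C / e)).+1%:R by exact: truncnS_gt.
rewrite ltr_pdivrMr// in h.
set T := _%:R in h *; move=> hT; have T0 : 0 < T by rewrite ltr0n.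
by rewrite -(ler_pM2l T0); apply: le_trans hT _; exact: ltW.
Qed.

(** Level k is described from every higher level up to an error proportional to the mass there; what
    is bounded by all these errors vanishes. *)
Lemma optower_small k (z C : R) : 0 <= C ->
  (forall j, `|z| <= C * fm (mu (j + k)%N) setT) -> z = 0.
Proof.
move=> C0 h; apply/eqP; rewrite -normr_le0; apply/ler_addgt0Pr => e e0.
rewrite add0r; have C1 : 0 < C + 1 by rewrite ltr_wpDl.
have [N hN] := optower_mass (divr_gt0 e0 C1).
have := hN (N + k)%N (leq_addr _ _) => h1.
apply: le_trans (h N) _.
apply: (@le_trans _ _ ((C + 1) * (e / (C + 1)))).
  apply: ler_pM => //; first exact: fm_ge0.
  by rewrite lerDl.
by rewrite mulrC divfK// lt0r_neq0.
Qed.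

Lemma optower_inv k : inv_fin_measure (mu k).
Proof.
split; first exact: tmu.1.
move=> E mE; have mE' : measurable (sh 1 @^-1` E : set (S k)) by exact: measurable_sh.
rewrite -[@Defs.shift _ _ @^-1` E]/(sh 1 @^-1` E).
rewrite (fmE (tmu.1 k) mE) (fmE (tmu.1 k) mE'); congr EFin.
apply/eqP; rewrite -subr_eq0; apply/eqP.
apply: (@optower_small k _ 1) => // j; rewrite mul1r.
rewrite (optower_sigma_to j mE) (optower_sigma_to j mE').
by apply: op_shift_le => //; [exact: sigma_to_ne|exact: tmu.1].
Qed.

(** The word occurs in no sigma_[k,k+j)(a), so for every j only the error term of [op_occ] is
    left. *)
Lemma optower_lang k (w : seq (A k)) : ~ lang sigma k w -> fm (mu k) (cyl (a0 k) w) = 0.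
Proof.
move=> nw; apply: (@optower_small k _ (size w).+1%:R) => // j.
have mc : measurable (cyl (a0 k) w : set (S k)) by apply: sub_sigma_algebra; exists 1, w.
rewrite (optower_sigma_to j mc).
have := op_occ (a0 k) (@sigma_to_ne _ _ Hne k j) (tmu.1 (j + k)%N) w.
rewrite [X in `|_ - X|]big1 ?subr0// => a _.
suff -> : occ w (sigma_to sigma k j a) = 0%N by rewrite mulr0.
apply/eqP; rewrite /occ -leqn0 leqNgt -has_count; apply/hasPn => i _ /=.
apply/negP => /eqP wE; apply: nw; exists j, a.
set s := sigma_to _ _ _ _ in wE *; rewrite -wE.
exact: infix_trans (infix_take _ _) (infix_drop _ _).
Qed.

(** A point outside X_k shows a word outside the language in some window [-n, n]; for each n there
    are finitely many such words, and their cylinders are null. *)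
Lemma optower_X k : inM (X sigma k) (mu k).
Proof.
split; first exact: optower_inv.
pose E n : set (S k) := [set x | ~ lang sigma k (factor x (- n%:Z) n.*2.+1)].
have mE n : measurable (E n).
  by apply: local_measurable; exact: (local_factor _ _ [set w | ~ lang sigma k w]).
have E0 n : mu k (E n) = 0%E.
  pose G (w : n.*2.+1.-tuple (A k)) : set (S k) := @gcyl _ (a0 k) (- n%:Z) w.
  have mG w : measurable (G w) by apply: sub_sigma_algebra; exists (- n%:Z), w.
  rewrite (measure_sum (mu k) (mE n) mG).
  - apply: big1 => w _; have mEG := measurableI _ _ (mE n) (mG w).
    have [lw|nlw] := pselect (lang sigma k w).
      suff -> : E n `&` G w = set0 by rewrite measure0.
      by apply/seteqP; split=> // x []; rewrite /E /G/gcyl/= size_tuple => nl e; rewrite e in nl.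
    have mc : measurable (cyl (a0 k) w : set (S k)) by apply: sub_sigma_algebra; exists 1, (val w).
    have Gw0 : mu k (G w) = 0%E.
      have -> : G w = sh (- n%:Z - 1) @^-1` (cyl (a0 k) w).
        by apply/seteqP; split=> y; rewrite /G/cyl/gcyl/= factor_sh [1 + _]addrC subrK.
      by rewrite (inv_sh (optower_inv k).2)// (fmE (tmu.1 k))// optower_lang.
    by apply: (@subset_measure0 _ _ _ (mu k) _ (G w)).
  - move=> i j x _; rewrite /G/gcyl/= !size_tuple => e1 e2.
    by apply: val_inj; exact: etrans (esym e1) e2.
  - move=> x _.
    have s : size (factor x (- n%:Z) n.*2.+1) == n.*2.+1 by rewrite size_factor.
    by exists (Tuple s); rewrite /G/gcyl/mkset size_tuple.
rewrite /supported_in; apply: (@subset_measure0 _ _ _ (mu k) _ (\bigcup_n E n)).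
- by apply: measurableC; apply: sclosed_measurable; exact: X_sclosed.
- exact: bigcupT_measurable.
- move=> x /= nX; apply: contrapT => h; apply: nX; apply: X_windows => M.
  by exists M => //; apply: contrapT => h'; apply: h; exists M; [|exact: h'].
- apply: measure_negligible; first exact: bigcupT_measurable.
  apply: negligible_bigcup => n; exists (E n); split; [exact: mE|exact: E0|by []].
Qed.

Lemma optower_m_rel (v : forall n, A n -> R) :
  (forall n a, v n a = fm (mu n) (letter_set a)) -> m_rel a0 sigma v (mu 0%N).
Proof.
move=> vE w.
have mc : measurable (cyl (a0 0%N) w : set (S 0%N)) by apply: sub_sigma_algebra; exists 1, w.
rewrite (fmE (tmu.1 0%N) mc); apply: cvg_EFin; first by apply: nearW.
apply/cvgrPdist_le => e e0; have w0 : 0 < (size w).+1%:R :> R by [].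
have [N hN] := optower_mass (divr_gt0 e0 w0).
exists N => // n /= Nn; rewrite (optower_sig0 n mc).
rewrite (eq_bigr (fun a => fm (mu n) (letter_set a) * (occ w (sig0 sigma n a))%:R)).
  apply: le_trans (op_occ (a0 0%N) (@sig0_ne _ _ Hne n) (tmu.1 n) w) _.
  by rewrite mulrC -ler_pdivlMr//; exact: hN.
by move=> a _; rewrite vE.
Qed.

End OpTower.

(** * Realization of a vector tower by measures *)

Section VectorTower.
Variable v : forall n, A n -> R.
Arguments v : clear implicits.
Hypothesis tv : vtower sigma v.

Let dm n (E : set (int -> A n)) : R := \sum_(a : A n) v n a * (`[< E (fun=> a) >])%:R.

Let dm_ge0 n (E : set (int -> A n)) : 0 <= dm E.
Proof. by apply: sumr_ge0 => a _; apply: mulr_ge0 => //; exact: tv.1. Qed.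

Let dm0 n : @dm n set0 = 0.
Proof. by apply: big1 => a _; rewrite asboolF ?mulr0. Qed.

Let dmU n (E F : set (int -> A n)) : E `&` F = set0 -> dm (E `|` F) = dm E + dm F.
Proof.
move=> EF; rewrite /dm -big_split; apply: eq_bigr => a _ /=; rewrite -mulrDr -natrD.
congr (_ * _%:R); have [Ea|nEa] := pselect (E (fun=> a)).
  have nFa : ~ F (fun=> a) by move=> Fa; have : (E `&` F) (fun=> a) by []; rewrite EF.
  by rewrite (asboolT Ea) (asboolF nFa) asboolT//; left.
have [Fa|nFa] := pselect (F (fun=> a)).
  by rewrite (asboolT Fa) (asboolF nEa) asboolT//; right.
by rewrite (asboolF nFa) (asboolF nEa) asboolF// => -[].
Qed.

Let dm_letter n (a : A n) : dm (letter_set a) = v n a.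
Proof.
rewrite /dm (bigD1 a)//= asboolT// mulr1 big1 ?addr0// => b /eqP ba.
by rewrite asboolF ?mulr0.
Qed.

(** The atomic masses of level n brought down to level k. If n < k the truncated difference keeps
    level k itself; the limit sees only large n. *)
Let r k n (E : set (int -> A k)) : R :=
  op (a0 k) (sigma_to sigma k (n - k)) (@dm ((n - k) + k)%N) E.

Let r_ge0 k n (E : set (int -> A k)) : 0 <= r n E.
Proof. exact: op_ge0. Qed.

Let rU k n (E F : set (int -> A k)) : E `&` F = set0 -> r n (E `|` F) = r n E + r n F.
Proof. by apply: opU => *; exact: dmU. Qed.

(** The tower relation of v says that the incidence matrices reproduce v, so the letter masses at
    level k do not depend on the starting level and pass unchanged to the limit. *)
Let op_dm_letter k j (b : A k) :
  op (a0 k) (sigma_to sigma k j) (@dm (j + k)%N) (letter_set b) = v k b.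
Proof.
elim: j => [|j IH].
  rewrite op_letter// (bigD1 b)//= eqxx mulr1 dm_letter big1 ?addr0// => a /negPf.
  by rewrite eq_sym eq_sym => ->; rewrite mulr0.
have ns := @sigma_to_ne _ _ Hne k j.
rewrite -(@op_comp _ _ _ _ (a0 (j + k)%N) (a0 k) _ _ _ (letter_set b) ns (Hne _) (dm0 _)).
rewrite -[RHS]IH (@op_letter _ _ _ (a0 k) _ ns); last by apply: op0; exact: dm0.
rewrite (@op_letter _ _ _ (a0 k) _ ns)//.
apply: eq_bigr => a _; congr (_ * _); rewrite dm_letter.
rewrite (@op_letter _ _ _ (a0 (j + k)%N) _ (Hne _))//.
by rewrite tv.2; apply: eq_bigr => c _; rewrite mulrC dm_letter.
Qed.

Let r_le k n (E : set (int -> A k)) : r n E <= \sum_(b : A k) v k b.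
Proof.
have -> : \sum_(b : A k) v k b = r n [set: int -> A k].
  rewrite /r opT; under [RHS]eq_bigr do rewrite size_sum_count natr_sum mulr_sumr.
  rewrite exchange_big; apply: eq_bigr => b _ /=.
  by rewrite -(@op_letter _ _ _ (a0 k) _ (@sigma_to_ne _ _ Hne k (n - k)))// op_dm_letter.
have <- : E `|` ~` E = setT by rewrite setUv.
by rewrite rU ?setICr// lerDl.
Qed.

Lemma vtower_optower : exists mu : forall n, {measure set (S n) -> \bar R},
  optower mu /\ forall n a, v n a = fm (mu n) (letter_set a).
Proof.
have [U [UU sU]] := @ultraFilterLemma nat \oo _.
have PF : ProperFilter U by exact: ultra_proper.
have lims k (E : set (int -> A k)) : exists l : R, (fun n => r n E) @ U --> l.
  by apply: (ultra_cvg (C := \sum_(b : A k) v k b)) => n; rewrite r_ge0 r_le.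
pose rho k (E : set (int -> A k)) : R := sval (cid (lims k E)).
have rhoP k (E : set (int -> A k)) : (fun n => r n E) @ U --> rho k E.
  by rewrite /rho; case: cid.
have rho_uniq k (E : set (int -> A k)) (l : R) : (fun n => r n E) @ U --> l -> l = rho k E.
  by move=> h; exact: norm_cvg_unique h (rhoP k E).
have ext k : exists mu : {measure set (S k) -> \bar R},
    forall E, local E -> mu E = (rho k E)%:E.
  apply: local_measure_extension => [E|E F _ _ EF].
    rewrite -(cvg_lim _ (rhoP k E))//; apply: limr_ge.
      by apply/cvg_ex; exists (rho k E); exact: rhoP.
    by apply: nearW => n; exact: r_ge0.
  apply/esym/rho_uniq; rewrite (_ : (fun _ => _) = (fun n => r n E) \+ (fun n => r n F)).
    exact: cvgD.
  by apply/funext => n; rewrite rU.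
pose mu k := sval (cid (ext k)).
have muE k (E : set (int -> A k)) : local E -> mu k E = (rho k E)%:E.
  by rewrite /mu; case: cid => m hm; exact: hm.
have fmu k : (mu k setT < +oo)%E by rewrite muE ?ltry//; exact: localT.
have fmE k (E : set (int -> A k)) : local E -> fm (mu k) E = rho k E.
  by move=> lE; rewrite /fm muE.
(* The transfers to levels k and k + 1 start from the same level only when k < n, which holds
   eventually along the ultrafilter. *)
have rS k n (E : set (int -> A k)) : (k < n)%N ->
    r n E = op (a0 k) (sigma k) (fun F => r n F) E.
  move=> kn; rewrite /r.
  rewrite (@op_comp _ _ _ _ (a0 k.+1) (a0 k) _ _ _ E (Hne k)
    (@sigma_to_ne _ _ Hne k.+1 (n - k.+1)) (dm0 _)).
  have -> : (n - k = (n - k.+1).+1)%N by lia.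
  by have /= <- := @sigma_toS A sigma k (n - k.+1)%N
    (fun m g => op (a0 k) (sigma_to sigma k (n - k.+1).+1) (@dm ((n - k.+1).+1 + k)%N) E
               = op (a0 k) g (@dm m) E).
have rhoS k (E : set (int -> A k)) : rho k E = op (a0 k) (sigma k) (rho k.+1) E.
  apply/esym/rho_uniq.
  have c : (fun n => op (a0 k) (sigma k) (fun F => r n F) E) @ U -->
      op (a0 k) (sigma k) (rho k.+1) E.
    by apply: cvg_sumr => a; apply: cvg_sumr_ord => i; exact: rhoP.
  apply: cvg_trans c; apply: near_eq_cvg; apply: sU.
  by exists k.+1 => // n /= kn; rewrite rS.
exists mu; split; last first.
  move=> n a; rewrite fmE; last exact: local_letter_set.
  apply: rho_uniq; rewrite (_ : (fun _ => _) = cst (v n a)); first exact: cvg_cst.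
  by apply/funext => m; rewrite /r op_dm_letter.
split=> // n E mE.
have [nu [fnu nuE]] := op_measure (a0 n) (sigma n) (fmu n.+1).
(* The relation passes to the limit on clopen sets; uniqueness of the extension carries it to all
   measurable sets. *)
have h : meq (mu n) nu.
  apply: meq_local => // F lF; rewrite nuE; last exact: local_measurable.
  rewrite muE// rhoS; congr EFin; apply: eq_bigr => a _; apply: eq_bigr => k _.
  apply/esym/fmE; apply: localI; first exact: local_letter_set.
  exact: (fZ_local (a0 n) (sigma n) (local_sh _ lF)).
by rewrite /fm (h E mE) nuE.
Qed.

End VectorTower.
End Towers.

(** * Correspondence between towers and measures on the subshifts *)

Section Correspondence.
Variables (R : realType) (A : nat -> finType) (a0 : forall n, A n)
  (sigma : forall n, A n.+1 -> seq (A n)).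
Arguments sigma : clear implicits.
Hypothesis Hne : non_erasing_seq sigma.
Arguments Hne : clear implicits.
Local Notation S n := (shspace (a0 n)).

Lemma m_rel_cyl (v : forall n, A n -> R) (mu1 mu2 : {measure set (S 0%N) -> \bar R}) :
  m_rel a0 sigma v mu1 -> m_rel a0 sigma v mu2 ->
  forall w, mu1 (cyl (a0 0%N) w) = mu2 (cyl (a0 0%N) w).
Proof.
move=> h1 h2 w; apply: (cvg_unique _ (h1 w) (h2 w)).
exact: ereal_hausdorff.
Qed.

Lemma zetaE (mu : forall n, {measure set (S n) -> \bar R}) n a :
  zeta mu n a = fm (mu n) (letter_set a).
Proof. by rewrite /zeta cyl_letter_set. Qed.

Lemma optower_vtower (mu : forall n, {measure set (S n) -> \bar R})
    (v : forall n, A n -> R) : optower sigma mu ->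
  (forall n a, v n a = fm (mu n) (letter_set a)) -> vtower sigma v.
Proof.
move=> tmu vE; split=> [n a|n b]; first by rewrite vE; exact: fm_ge0.
rewrite vE (tmu.2 n) ?(op_letter _ (Hne n)) ?fm0//.
  by apply: eq_bigr => a _; rewrite vE mulrC.
exact: measurable_letter_set.
Qed.

Lemma mtower_optower (mu : forall n, {measure set (S n) -> \bar R}) :
  mtower sigma mu -> optower sigma mu.
Proof.
move=> [imu tr]; split=> [n|n E mE]; first exact: (imu n).1.
by rewrite {1}/fm (transfer_op (Hne n) (imu n.+1) (imu n) (tr n) mE).
Qed.

(** Shifts of f^Z send X_(n+1) into X_n, so on each floor the complement of X_n pulls back to a null
    set. *)
Lemma op_X n (mu : {measure set (S n.+1) -> \bar R}) : inM (X sigma n.+1) mu ->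
  exists nu : {measure set (S n) -> \bar R}, inM (X sigma n) nu /\
    forall E : set (S n), measurable E -> nu E = (op (a0 n) (sigma n) (fm mu) E)%:E.
Proof.
move=> [imu sX]; have [nu [inu nuE]] := op_measure_inv (a0 n) (Hne n) imu.
exists nu; split=> //; split=> //.
have mX : measurable (~` X sigma n : set (S n)).
  by apply: measurableC; apply: sclosed_measurable; exact: X_sclosed.
have mX' : measurable (~` X sigma n.+1 : set (S n.+1)).
  by apply: measurableC; apply: sclosed_measurable; exact: X_sclosed.
rewrite /supported_in nuE//; congr EFin; apply: big1 => a _; apply: big1 => k _.
rewrite -[RHS](fm0 mu); apply: (eq_fm_null imu.1 mX' sX).
- exact: measurable_op_setI.
- exact: measurable0.
- by move=> x /contrapT Xx; split=> // -[_] /=; apply; exact: X_fZ.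
Qed.

Hypothesis Hrec : totally_recognizable sigma.
Arguments Hrec : clear implicits.

Lemma op_X_inj n (mu1 mu2 : {measure set (S n.+1) -> \bar R}) :
  inM (X sigma n.+1) mu1 -> inM (X sigma n.+1) mu2 ->
  (forall E : set (S n), measurable E ->
     op (a0 n) (sigma n) (fm mu1) E = op (a0 n) (sigma n) (fm mu2) E) ->
  meq mu1 mu2.
Proof.
apply: op_inj; [exact: Hne|exact: X_sclosed|exact: (Hrec n)].
Qed.

Lemma op_X_surj n (nu : {measure set (S n) -> \bar R}) : inM (X sigma n) nu ->
  exists mu : {measure set (S n.+1) -> \bar R}, inM (X sigma n.+1) mu /\
    forall E : set (S n), measurable E -> nu E = (op (a0 n) (sigma n) (fm mu) E)%:E.
Proof.
apply: op_surj; [exact: Hne|exact: X_sclosed|exact: X_sh|exact: (Hrec n)| |exact: X_cover].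
by apply: sclosed_measurable; exact: X_sclosed.
Qed.

Lemma optower_exists (nu : {measure set (S 0%N) -> \bar R}) : inM (X sigma 0%N) nu ->
  exists2 mu : forall n, {measure set (S n) -> \bar R}, optower sigma mu & mu 0%N = nu.
Proof.
(* The recursion carries along the proof that the measure lives on X_n, which the next step upwards
   requires. *)
move=> Xnu; pose T n := {mu : {measure set (S n) -> \bar R} | inM (X sigma n) mu}.
have step n (m : T n) : {m' : T n.+1 | forall E : set (S n), measurable E ->
    fm (sval m) E = op (a0 n) (sigma n) (fm (sval m')) E}.
  have [mu' [Xmu' h]] := cid (op_X_surj (svalP m)).
  by exists (exist _ mu' Xmu') => E mE; rewrite {1}/fm h.
pose tow := nat_rect T (exist _ nu Xnu) (fun n m => sval (step n m)).
exists (fun n => sval (tow n)) => //; split=> [n|n E mE].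
  exact: (svalP (tow n)).1.1.
exact: (svalP (step n (tow n))).
Qed.

Lemma op_sig0 n (mu : {measure set (S n) -> \bar R}) : inM (X sigma n) mu ->
  exists nu : {measure set (S 0%N) -> \bar R}, inM (X sigma 0%N) nu /\
    forall E : set (S 0%N), measurable E ->
      nu E = (op (a0 0%N) (sig0 sigma n) (fm mu) E)%:E.
Proof.
elim: n mu => [|n IH] mu Xmu.
  by exists mu; split=> // E mE; rewrite (op_id Xmu.1.1 mE) (fmE Xmu.1.1 mE).
have [mu' [Xmu' h]] := op_X Xmu; have [nu [Xnu nuE]] := IH mu' Xmu'.
exists nu; split=> // E mE; rewrite nuE//; congr EFin.
rewrite -(@op_comp _ _ _ _ (a0 n) (a0 0%N) _ _ _ E (@sig0_ne _ _ Hne n) (Hne n) (fm0 _)).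
by apply: (op_ext (a0 := a0 n) _ mE) => F mF; rewrite {1}/fm h.
Qed.

(** By induction the transfers to level n already agree; recognizability of the top morphism sigma_n
    then gives equality above. *)
Lemma op_sig0_inj n (mu1 mu2 : {measure set (S n) -> \bar R}) :
  inM (X sigma n) mu1 -> inM (X sigma n) mu2 ->
  (forall E : set (S 0%N), measurable E ->
     op (a0 0%N) (sig0 sigma n) (fm mu1) E = op (a0 0%N) (sig0 sigma n) (fm mu2) E) ->
  meq mu1 mu2.
Proof.
elim: n mu1 mu2 => [|n IH] mu1 mu2 X1 X2 h.
  move=> E mE; have := h E mE; rewrite (op_id X1.1.1 mE) (op_id X2.1.1 mE) => e.
  by rewrite (fmE X1.1.1 mE) (fmE X2.1.1 mE) e.
have [mu1' [X1' h1]] := op_X X1; have [mu2' [X2' h2]] := op_X X2.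
suff e : meq mu1' mu2'.
  apply: op_X_inj => // E mE; apply: EFin_inj.
  by rewrite -h1// -h2//; exact: e.
apply: IH => // E mE.
have := h E mE => /=.
rewrite -!(@op_comp _ _ _ _ (a0 n) (a0 0%N) _ _ _ E (@sig0_ne _ _ Hne n) (Hne n) (fm0 _)).
have step (mu' : {measure set (S n) -> \bar R}) (mu : {measure set (S n.+1) -> \bar R}) :
    (forall E : set (S n), measurable E -> mu' E = (op (a0 n) (sigma n) (fm mu) E)%:E) ->
    op (a0 0%N) (sig0 sigma n) (fm mu') E =
    op (a0 0%N) (sig0 sigma n) (op (a0 n) (sigma n) (fm mu)) E.
  by move=> hm; apply: (op_ext (a0 := a0 n) _ mE) => F mF; rewrite {1}/fm hm.
by rewrite (step _ _ h1) (step _ _ h2).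
Qed.

Lemma op_sig0_surj n (nu : {measure set (S 0%N) -> \bar R}) : inM (X sigma 0%N) nu ->
  exists mu : {measure set (S n) -> \bar R}, inM (X sigma n) mu /\
    forall E : set (S 0%N), measurable E ->
      nu E = (op (a0 0%N) (sig0 sigma n) (fm mu) E)%:E.
Proof.
move=> Xnu; elim: n => [|n [mu' [Xmu' h']]].
  by exists nu; split=> // E mE; rewrite (op_id Xnu.1.1 mE) (fmE Xnu.1.1 mE).
have [mu [Xmu h]] := op_X_surj Xmu'; exists mu; split=> // E mE; rewrite h'//.
congr EFin.
rewrite -(@op_comp _ _ _ _ (a0 n) (a0 0%N) _ _ _ E (@sig0_ne _ _ Hne n) (Hne n) (fm0 _)).
by apply: (op_ext (a0 := a0 n) _ mE) => F mF; rewrite {1}/fm h.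
Qed.

Hypothesis Hgrow : everywhere_growing sigma.

Lemma optower_mtower (mu : forall n, {measure set (S n) -> \bar R}) :
  optower sigma mu -> mtower sigma mu.
Proof.
move=> tmu; split=> n; first exact: (optower_inv Hne tmu Hgrow n).
apply: op_transfer; [exact: Hne|exact: (optower_inv Hne tmu Hgrow n.+1)|].
by move=> E mE; rewrite (fmE (tmu.1 n) mE) (tmu.2 n).
Qed.

Lemma optower_inj (mu1 mu2 : forall n, {measure set (S n) -> \bar R}) :
  optower sigma mu1 -> optower sigma mu2 ->
  (forall w, mu1 0%N (cyl (a0 0%N) w) = mu2 0%N (cyl (a0 0%N) w)) ->
  forall n, meq (mu1 n) (mu2 n).
Proof.
move=> t1 t2 h; elim=> [|n IH].
  by apply: meq_cyl => [||w _]; [exact: (optower_inv Hne t1 Hgrow 0%N)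
    |exact: (optower_inv Hne t2 Hgrow 0%N)|exact: h].
apply: op_X_inj; [exact: (optower_X Hne t1 Hgrow n.+1)|exact: (optower_X Hne t2 Hgrow n.+1)|].
by move=> E mE; rewrite -(t1.2 n)// -(t2.2 n)// /fm (IH E mE).
Qed.

End Correspondence.

Theorem theorem5p7 (R : realType) (A : nat -> finType) (a0 : forall n, A n)
  (sigma : forall n, A n.+1 -> seq (A n))
  (Hne : non_erasing_seq sigma)
  (Hgrow : everywhere_growing sigma)
  (Hrec : totally_recognizable sigma) :
  (* m_sigma : V(sigma) -> M(X) is a well-defined bijection *)
  ((forall v : forall n, A n -> R, vtower sigma v ->
      exists mu : {measure set (shspace (a0 0%N)) -> \bar R},
        inM (X sigma 0%N) mu /\ m_rel a0 sigma v mu) /\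
   (forall (v : forall n, A n -> R) (mu1 mu2 : {measure set (shspace (a0 0%N)) -> \bar R}),
      vtower sigma v -> inv_fin_measure mu1 -> inv_fin_measure mu2 ->
      m_rel a0 sigma v mu1 -> m_rel a0 sigma v mu2 -> meq mu1 mu2) /\
   (forall (v1 v2 : forall n, A n -> R) (mu : {measure set (shspace (a0 0%N)) -> \bar R}),
      vtower sigma v1 -> vtower sigma v2 ->
      m_rel a0 sigma v1 mu -> m_rel a0 sigma v2 mu ->
      forall n a, v1 n a = v2 n a) /\
   (forall mu : {measure set (shspace (a0 0%N)) -> \bar R}, inM (X sigma 0%N) mu ->
      exists v : forall n, A n -> R, vtower sigma v /\ m_rel a0 sigma v mu)) /\
  (* sigma_[0,n)^M : M(X_n) -> M(X) is a well-defined bijection *)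
  (forall n : nat,
   (forall mu : {measure set (shspace (a0 n)) -> \bar R}, inM (X sigma n) mu ->
      exists nu : {measure set (shspace (a0 0%N)) -> \bar R},
        inM (X sigma 0%N) nu /\ transfer (a0 n) (a0 0%N) (sig0 sigma n) mu nu) /\
   (forall (mu : {measure set (shspace (a0 n)) -> \bar R})
           (nu1 nu2 : {measure set (shspace (a0 0%N)) -> \bar R}),
      inM (X sigma n) mu -> inv_fin_measure nu1 -> inv_fin_measure nu2 ->
      transfer (a0 n) (a0 0%N) (sig0 sigma n) mu nu1 ->
      transfer (a0 n) (a0 0%N) (sig0 sigma n) mu nu2 -> meq nu1 nu2) /\
   (forall (mu1 mu2 : {measure set (shspace (a0 n)) -> \bar R})
           (nu : {measure set (shspace (a0 0%N)) -> \bar R}),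
      inM (X sigma n) mu1 -> inM (X sigma n) mu2 ->
      transfer (a0 n) (a0 0%N) (sig0 sigma n) mu1 nu ->
      transfer (a0 n) (a0 0%N) (sig0 sigma n) mu2 nu -> meq mu1 mu2) /\
   (forall nu : {measure set (shspace (a0 0%N)) -> \bar R}, inM (X sigma 0%N) nu ->
      exists mu : {measure set (shspace (a0 n)) -> \bar R},
        inM (X sigma n) mu /\ transfer (a0 n) (a0 0%N) (sig0 sigma n) mu nu)) /\
  (* m_sigma o zeta : M(sigma) -> M(X) is a well-defined bijection *)
  ((forall mu : forall n, {measure set (shspace (a0 n)) -> \bar R},
      mtower sigma mu -> vtower sigma (zeta mu)) /\
   (forall mu : forall n, {measure set (shspace (a0 n)) -> \bar R},
      mtower sigma mu ->
      exists nu : {measure set (shspace (a0 0%N)) -> \bar R},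
        inM (X sigma 0%N) nu /\ m_rel a0 sigma (zeta mu) nu) /\
   (forall (mu1 mu2 : forall n, {measure set (shspace (a0 n)) -> \bar R})
           (nu : {measure set (shspace (a0 0%N)) -> \bar R}),
      mtower sigma mu1 -> mtower sigma mu2 ->
      m_rel a0 sigma (zeta mu1) nu -> m_rel a0 sigma (zeta mu2) nu ->
      forall n, meq (mu1 n) (mu2 n)) /\
   (forall nu : {measure set (shspace (a0 0%N)) -> \bar R}, inM (X sigma 0%N) nu ->
      exists mu : forall n, {measure set (shspace (a0 n)) -> \bar R},
        mtower sigma mu /\ m_rel a0 sigma (zeta mu) nu)).
Proof.
(* One injectivity argument serves m_sigma and its composition with zeta: the bottom measure of
   either tower has the cylinder values of mu. *)
have unique_v (v1 v2 : forall n, A n -> R)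
    (mu1 mu2 : forall n, {measure set (shspace (a0 n)) -> \bar R})
    (mu : {measure set (shspace (a0 0%N)) -> \bar R}) :
    optower sigma mu1 -> optower sigma mu2 ->
    (forall n a, v1 n a = fm (mu1 n) (letter_set a)) ->
    (forall n a, v2 n a = fm (mu2 n) (letter_set a)) ->
    m_rel a0 sigma v1 mu -> m_rel a0 sigma v2 mu -> forall n, meq (mu1 n) (mu2 n).
  move=> t1 t2 e1 e2 m1 m2; apply: (optower_inj Hne Hrec Hgrow) => // w.
  rewrite (m_rel_cyl (optower_m_rel Hne t1 Hgrow e1) m1).
  by rewrite (m_rel_cyl (optower_m_rel Hne t2 Hgrow e2) m2).
split; [split; [|split; [|split]]|split; [|split; [|split; [|split]]]].
- move=> v /(vtower_optower a0 Hne)[mu [tmu vE]]; exists (mu 0%N); split.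
    exact: (optower_X Hne tmu Hgrow 0%N).
  exact: (optower_m_rel Hne tmu Hgrow vE).
- move=> v mu1 mu2 _ i1 i2 m1 m2; apply: meq_cyl => // w _.
  exact: (m_rel_cyl m1 m2).
- move=> v1 v2 mu tv1 tv2 m1 m2 n a.
  have [mu1 [t1 e1]] := vtower_optower a0 Hne tv1.
  have [mu2 [t2 e2]] := vtower_optower a0 Hne tv2.
  have h := unique_v _ _ _ _ _ t1 t2 e1 e2 m1 m2.
  by rewrite e1 e2 /fm h//; exact: measurable_letter_set.
- move=> mu Xmu; have [t tt <-] := optower_exists Hne Hrec Xmu.
  exists (fun n a => fm (t n) (letter_set a)); split.
    exact: (optower_vtower Hne tt).
  exact: (optower_m_rel Hne tt Hgrow).
- move=> n; split; [|split; [|split]].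
  + move=> mu Xmu; have [nu [Xnu nuE]] := op_sig0 Hne Xmu; exists nu; split=> //.
    by apply: op_transfer => //; [exact: sig0_ne|exact: Xmu.1].
  + move=> mu nu1 nu2 _ i1 i2 t1 t2; apply: meq_cyl => // w w0.
    by rewrite (t1 w w0) (t2 w w0).
  + move=> mu1 mu2 nu X1 X2 t1 t2.
    (* The measures nu1 and nu2 given by [op] are invariant and share the values of nu on nonempty
       cylinders, hence coincide. *)
    have [nu1 [X1' e1]] := op_sig0 Hne X1; have [nu2 [X2' e2]] := op_sig0 Hne X2.
    have h : meq nu1 nu2.
      apply: (meq_cyl X1'.1 X2'.1) => w w0.
      rewrite (op_transfer (@sig0_ne _ _ Hne n) X1.1 e1 w0) -(t1 w w0).
      by rewrite (op_transfer (@sig0_ne _ _ Hne n) X2.1 e2 w0) -(t2 w w0).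
    apply: (op_sig0_inj Hne Hrec X1 X2) => E mE; apply: EFin_inj.
    by rewrite -e1// -e2// (h E mE).
  + move=> nu Xnu; have [mu [Xmu nuE]] := op_sig0_surj Hne Hrec n Xnu.
    exists mu; split=> //.
    by apply: op_transfer => //; [exact: sig0_ne|exact: Xmu.1].
- move=> mu /(mtower_optower Hne) tmu; apply: (optower_vtower Hne tmu) => n a.
  exact: zetaE.
- move=> mu /(mtower_optower Hne) tmu; exists (mu 0%N); split.
    exact: (optower_X Hne tmu Hgrow 0%N).
  by apply: (optower_m_rel Hne tmu Hgrow) => n a; exact: zetaE.
- move=> mu1 mu2 nu /(mtower_optower Hne) t1 /(mtower_optower Hne) t2 m1 m2.
  exact: (unique_v _ _ _ _ _ t1 t2 (zetaE _) (zetaE _) m1 m2).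
- move=> nu Xnu; have [t tt <-] := optower_exists Hne Hrec Xnu; exists t; split.
    exact: (optower_mtower Hne Hgrow tt).
  by apply: (optower_m_rel Hne tt Hgrow) => n a; exact: zetaE.
Qed.
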